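(* For all $\tau\in\mathbb{H}$: (1) $g(\tau)-g(\tau)^2-4g(\tau)g(2\tau)-g(2\tau)^2+5g(\tau)g(2\tau)^2=0$; (2) $U(\tau)^4+4U(\tau)^2U(2\tau)^2+U(2\tau)^4=U(2\tau)^2\bigl(1+5U(\tau)^4\bigr)$.
   Context: $q=e^{2\pi i\tau}$, $q^r=e^{2\pi i r\tau}$ for rational $r$, $(a;q)_\infty=\prod_{k\ge0}(1-aq^k)$, $\eta(\tau)=q^{1/24}(q;q)_\infty$. $g(\tau)=\dfrac{\eta^2(2\tau)\eta^4(5\tau)}{\eta^4(\tau)\eta^2(10\tau)}$. $U(\tau)=I(\tau)/J(\tau)$ where $I(\tau)=q^{3/4}\dfrac{(q;q^{10})_\infty(q^9;q^{10})_\infty}{(q^4;q^{10})_\infty(q^6;q^{10})_\infty}$ and $J(\tau)=q^{1/4}\dfrac{(q^2;q^{10})_\infty(q^8;q^{10})_\infty}{(q^3;q^{10})_\infty(q^7;q^{10})_\infty}$. *)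

(* Defs.v *)
From Stdlib Require Import Reals List.
From Coquelicot Require Import Coquelicot.
Open Scope R_scope.

Definition cexp (z : C) : C :=
  (exp (Re z) * cos (Im z), exp (Re z) * sin (Im z)).

Definition qpow (r : R) (tau : C) : C :=
  cexp (Cmult (RtoC (2 * PI * r)) (Cmult Ci tau)).

Definition pprod (f : nat -> C) (n : nat) : C :=
  fold_right (fun k acc => Cmult (f k) acc) (RtoC 1) (seq 0 n).

Definition infprod (f : nat -> C) : C :=
  (real (Lim_seq (fun n => Re (pprod f n))),
   real (Lim_seq (fun n => Im (pprod f n)))).

Definition qpoch (a m : nat) (tau : C) : C :=
  infprod (fun k => Cminus (RtoC 1) (qpow (INR (a + m * k)) tau)).

Definition eta (tau : C) : C := Cmult (qpow (1/24) tau) (qpoch 1 1 tau).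

Definition cscale (n : R) (tau : C) : C := Cmult (RtoC n) tau.

Definition g (tau : C) : C :=
  Cdiv (Cmult (Cpow (eta (cscale 2 tau)) 2) (Cpow (eta (cscale 5 tau)) 4))
       (Cmult (Cpow (eta tau) 4) (Cpow (eta (cscale 10 tau)) 2)).

Definition Ifun (tau : C) : C :=
  Cmult (qpow (3/4) tau)
    (Cdiv (Cmult (qpoch 1 10 tau) (qpoch 9 10 tau))
          (Cmult (qpoch 4 10 tau) (qpoch 6 10 tau))).

Definition Jfun (tau : C) : C :=
  Cmult (qpow (1/4) tau)
    (Cdiv (Cmult (qpoch 2 10 tau) (qpoch 8 10 tau))
          (Cmult (qpoch 3 10 tau) (qpoch 7 10 tau))).

Definition U (tau : C) : C := Cdiv (Ifun tau) (Jfun tau).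

(* Main.v *)
Require Import Defs.
From Stdlib Require Import Reals Lra Lia ZArith.
From Coquelicot Require Import Coquelicot.
From HB Require Import structures.
From mathcomp Require Import all_boot.
From mathcomp Require Import ssrZ zify.

(* Write E_k = (q^k; q^k)_oo and psi(q) = E_2^2 / E_1.  The products collapse to
   A := U(tau)^2 = q psi(q^5)^2 / psi(q)^2, and g(tau) = (1 - A) / (1 - 5 A).
   With B := U(2 tau)^2, both parts then amount to
     (A - B)^2 = B (1 - A) (1 - 5 A).
   This follows from three theta function identities (phi(q) = sum q^(n^2)):
     psi(q)^2 - q psi(q^5)^2 = E_5^3 E_2 / (E_1 E_10),
     psi(q)^2 - 5 q psi(q^5)^2 = E_1^3 E_10 / (E_2 E_5),
     psi(q^2) phi(q^5) - q psi(q^10) phi(q) = E_1 E_5.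
   By the Jacobi triple product each side is a sum over Z^2 of powers of q with
   a binary quadratic form in the exponent (x^2 + y^2 for the first two,
   x^2 + 5 y^2 for the third), and the identities are reindexings of these
   absolutely convergent sums. *)

Set Implicit Arguments.
Unset Strict Implicit.
Unset Printing Implicit Defensive.

Local Open Scope C_scope.
Local Open Scope R_scope.

(** The three identities are exactly what is needed to write A - B, 1 - A and 1 - 5 A as quotients
    of the E_k, as B already is; the relation between A and B then compares two monomials. Under the
    Möbius substitution for g the cubic of part (1) becomes a multiple of (A - B)^2 - B (1 - A) (1 -
    5 A), and part (2) is that relation expanded. Three constraints shape the analysis. The lattice
    maps respect no convenient order of Z^2, so sums are taken as limits over finite subsets.
    [infprod] is built from [Lim_seq], which returns a value even without a limit, so no product can
    be evaluated before its convergence is proved. Series are parametrised by a logarithm s of q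
    rather than by q: negative and fractional powers, signs and roots of unity all become summands
    of one exponent, and each reindexing is a polynomial identity modulo 2 pi i. *)

Lemma RplusA (x y z : R) : x + (y + z) = x + y + z.
Proof. lra. Qed.
Lemma CplusA (x y z : C) : Cplus x (Cplus y z) = Cplus (Cplus x y) z.
Proof. ring. Qed.
Lemma CmultA (x y z : C) : Cmult x (Cmult y z) = Cmult (Cmult x y) z.
Proof. ring. Qed.
Lemma CmultDl (x y z : C) :
  Cmult (Cplus x y) z = Cplus (Cmult x z) (Cmult y z).
Proof. ring. Qed.
Lemma CmultDr (x y z : C) :
  Cmult x (Cplus y z) = Cplus (Cmult x y) (Cmult x z).
Proof. ring. Qed.

HB.instance Definition _ :=
  Monoid.isComLaw.Build C (RtoC 0) Cplus CplusA Cplus_comm Cplus_0_l.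
HB.instance Definition _ :=
  Monoid.isComLaw.Build C (RtoC 1) Cmult CmultA Cmult_comm Cmult_1_l.
HB.instance Definition _ :=
  Monoid.isMulLaw.Build C (RtoC 0) Cmult Cmult_0_l Cmult_0_r.
HB.instance Definition _ :=
  Monoid.isAddLaw.Build C Cmult Cplus CmultDl CmultDr.
HB.instance Definition _ :=
  Monoid.isComLaw.Build R 0 Rplus RplusA Rplus_comm Rplus_0_l.
HB.instance Definition _ :=
  Monoid.isMulLaw.Build R 0 Rmult Rmult_0_l Rmult_0_r.
HB.instance Definition _ :=
  Monoid.isAddLaw.Build R Rmult Rplus Rmult_plus_distr_r Rmult_plus_distr_l.

(** * Unordered sums *)

Definition csum (I : Type) (s : seq I) (f : I -> C) : C :=
  \big[Cplus/RtoC 0]_(i <- s) f i.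
Definition rsum (I : Type) (s : seq I) (f : I -> R) : R :=
  \big[Rplus/0]_(i <- s) f i.

(** Convergence along finite subsets ordered by inclusion: no enumeration of the index type is
    chosen, so reindexing by a bijection costs nothing. *)
Definition has_sum (I : eqType) (f : I -> C) (a : C) : Prop :=
  forall eps : R, 0 < eps -> exists s0 : seq I, forall s : seq I,
    uniq s -> {subset s0 <= s} -> Cmod (csum s f - a)%C < eps.
Definition abs_bounded (I : eqType) (f : I -> C) : Prop :=
  exists B : R, forall s : seq I, uniq s -> rsum s (fun i => Cmod (f i)) <= B.

Lemma Cmod_csum (I : Type) (s : seq I) (f : I -> C) :
  Cmod (csum s f) <= rsum s (fun i => Cmod (f i)).
Proof.
rewrite /csum /rsum; elim: s => [|i s IH].
  by rewrite !big_nil Cmod_0; lra.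
rewrite !big_cons; apply: Rle_trans (Cmod_triangle _ _) _; lra.
Qed.

Lemma rsum_ge0 (I : Type) (s : seq I) (f : I -> R) :
  (forall i, 0 <= f i) -> 0 <= rsum s f.
Proof.
move=> f0; rewrite /rsum; elim: s => [|i s IH]; first by rewrite big_nil; lra.
by rewrite big_cons; move: (f0 i); lra.
Qed.

Lemma rsum_le (I : eqType) (s : seq I) (f g : I -> R) :
  (forall i, i \in s -> f i <= g i) -> rsum s f <= rsum s g.
Proof.
rewrite /rsum; elim: s => [|i s IH] fg; first by rewrite !big_nil; lra.
have h : rsum s f <= rsum s g.
  by apply: IH => j js; apply: fg; rewrite inE js orbT.
by move: h (fg i (mem_head _ _)); rewrite /rsum !big_cons; lra.
Qed.

Lemma csum_cat (I : Type) (s t : seq I) (f : I -> C) :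
  csum (s ++ t) f = (csum s f + csum t f)%C.
Proof. by rewrite /csum big_cat. Qed.

Lemma rsum_cat (I : Type) (s t : seq I) (f : I -> R) :
  rsum (s ++ t) f = rsum s f + rsum t f.
Proof. by rewrite /rsum big_cat. Qed.

Lemma perm_subset_filter (I : eqType) (s t : seq I) :
  uniq s -> uniq t -> {subset s <= t} ->
  perm_eq t (s ++ [seq x <- t | x \notin s]).
Proof.
move=> us ut st; apply: uniq_perm => //.
  rewrite cat_uniq us filter_uniq // andbT /=.
  by apply/hasPn => x; rewrite mem_filter => /andP[].
move=> x; rewrite mem_cat mem_filter.
by case: (boolP (x \in s)) => //= xs; rewrite st.
Qed.

Lemma csum_subset (I : eqType) (s t : seq I) (f : I -> C) :
  uniq s -> uniq t -> {subset s <= t} ->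
  csum t f = (csum s f + csum [seq x <- t | x \notin s] f)%C.
Proof.
move=> us ut st; rewrite -csum_cat; apply: perm_big.
exact: perm_subset_filter.
Qed.

Lemma rsum_subset (I : eqType) (s t : seq I) (f : I -> R) :
  uniq s -> uniq t -> {subset s <= t} ->
  rsum t f = rsum s f + rsum [seq x <- t | x \notin s] f.
Proof.
move=> us ut st; rewrite -rsum_cat; apply: perm_big.
exact: perm_subset_filter.
Qed.

Lemma csum_ext0 (I : eqType) (s : seq I) (f : I -> C) :
  (forall i, i \in s -> f i = RtoC 0) -> csum s f = RtoC 0.
Proof. by move=> h; rewrite /csum big1_seq // => i /andP[_]; apply: h. Qed.

Lemma has_sum_unique (I : eqType) (f : I -> C) (a b : C) :
  has_sum f a -> has_sum f b -> a = b.
Proof.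
move=> fa fb; suff h : Cmod (a - b)%C = 0.
  by rewrite (_ : a = (a - b + b)%C); [rewrite (Cmod_eq_0 _ h); ring | ring].
case: (Req_dec (Cmod (a - b)%C) 0) => // n0.
have d0 : 0 < Cmod (a - b)%C / 2 by move: (Cmod_ge_0 (a - b)%C); lra.
have [s ha] := fa _ d0; have [t hb] := fb _ d0.
have {}ha := ha (undup (s ++ t)) (undup_uniq _) _.
have {}hb := hb (undup (s ++ t)) (undup_uniq _) _.
have {}ha : Cmod (csum (undup (s ++ t)) f - a)%C < Cmod (a - b)%C / 2.
  by apply: ha => x xs; rewrite mem_undup mem_cat xs.
have {}hb : Cmod (csum (undup (s ++ t)) f - b)%C < Cmod (a - b)%C / 2.
  by apply: hb => x xs; rewrite mem_undup mem_cat xs orbT.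
set S := csum _ _ in ha hb.
have := Cmod_triangle (- (S - a))%C (S - b)%C.
rewrite Cmod_opp (_ : (- (S - a) + (S - b) = a - b)%C); last by ring.
lra.
Qed.

Lemma has_sum_ext (I : eqType) (f g : I -> C) (a : C) :
  (forall i, f i = g i) -> has_sum f a -> has_sum g a.
Proof.
move=> fg fa eps e0; have [s hs] := fa _ e0; exists s => t ut st.
suff -> : csum t g = csum t f by exact: hs.
by rewrite /csum; apply: eq_bigr => i _.
Qed.

Lemma has_sum_add (I : eqType) (f g : I -> C) (a b : C) :
  has_sum f a -> has_sum g b -> has_sum (fun i => f i + g i)%C (a + b)%C.
Proof.
move=> fa gb eps e0.
have e20 : 0 < eps / 2 by lra.
have [s hs] := fa _ e20; have [t ht] := gb _ e20.
exists (s ++ t) => u uu su.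
have {}hs := hs u uu _; have {}ht := ht u uu _.
have {}hs : Cmod (csum u f - a)%C < eps / 2.
  by apply: hs => x xs; apply: su; rewrite mem_cat xs.
have {}ht : Cmod (csum u g - b)%C < eps / 2.
  by apply: ht => x xs; apply: su; rewrite mem_cat xs orbT.
have -> : csum u (fun i => f i + g i)%C = (csum u f + csum u g)%C.
  by rewrite /csum big_split.
have := Cmod_triangle (csum u f - a)%C (csum u g - b)%C.
rewrite (_ : (csum u f - a + (csum u g - b) =
             csum u f + csum u g - (a + b))%C); last by ring.
lra.
Qed.

Lemma has_sum_scal (I : eqType) (c : C) (f : I -> C) (a : C) :
  has_sum f a -> has_sum (fun i => c * f i)%C (c * a)%C.
Proof.
move=> fa eps e0.
have c0 := Cmod_ge_0 c.
have e20 : 0 < eps / (Cmod c + 1) by apply: Rdiv_lt_0_compat; lra.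
have [s hs] := fa _ e20; exists s => t ut st.
have -> : csum t (fun i => c * f i)%C = (c * csum t f)%C.
  by rewrite /csum big_distrr.
rewrite (_ : (c * csum t f - c * a = c * (csum t f - a))%C); last by ring.
rewrite Cmod_mult; move: (hs t ut st) (Cmod_ge_0 (csum t f - a)%C).
set d := Cmod (_ - a)%C => hd d0.
have : d * (Cmod c + 1) < eps.
  have -> : eps = eps / (Cmod c + 1) * (Cmod c + 1) by field; lra.
  by apply: Rmult_lt_compat_r; lra.
nra.
Qed.

(** Extension by zero along the injection [h]. Its left inverse [k] makes membership in the image
    decidable, as [h (k i) == i], and carries the relevant part of a finite set back to J. *)
Lemma has_sum_image (I J : eqType) (h : J -> I) (k : I -> J) (f : J -> C)
    (a : C) :
  (forall j, k (h j) = j) -> has_sum f a ->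
  has_sum (fun i => if h (k i) == i then f (k i) else RtoC 0) a.
Proof.
move=> hK fa eps e0; have [s hs] := fa _ e0.
exists (map h s) => t ut st.
pose t' := [seq i <- t | h (k i) == i].
have ut' : uniq (map k t').
  rewrite map_inj_in_uniq ?filter_uniq // => i j.
  rewrite !mem_filter => /andP[/eqP hi _] /andP[/eqP hj _] e.
  by rewrite -hi e hj.
have := hs _ ut' _; rewrite /csum big_map big_filter => hb.
rewrite -big_mkcond; apply: hb => x xs.
apply/mapP; exists (h x); last by rewrite hK.
by rewrite mem_filter hK eqxx; apply: st; apply: map_f.
Qed.

(** A finite set whose absolute sum is within eps of the supremum leaves less than eps for any set
    disjoint from it. *)
Lemma bounded_tail (I : eqType) (f : I -> C) :
  abs_bounded f -> forall eps : R, 0 < eps ->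
  exists s0 : seq I, uniq s0 /\ forall s : seq I, uniq s ->
    (forall i, i \in s -> i \notin s0) -> rsum s (fun i => Cmod (f i)) < eps.
Proof.
move=> [B hB] eps e0.
pose E (x : R) := exists2 s : seq I, uniq s & x = rsum s (fun i => Cmod (f i)).
have [M [Mub Mleast]] : { m : R | is_lub E m }.
  apply: completeness; last by exists 0; exists [::] => //; rewrite /rsum big_nil.
  by exists B => x [s us ->]; apply: hB.
have [s0 us0 hs0] : exists2 s0 : seq I, uniq s0 &
    M - eps < rsum s0 (fun i => Cmod (f i)).
  apply: Classical_Prop.NNPP => no.
  have : is_upper_bound E (M - eps).
    move=> x [s us ->]; case: (Rle_dec (rsum s (fun i => Cmod (f i))) (M - eps)) => //.
    by move=> /Rnot_le_lt h; case: no; exists s.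
  by move/Mleast; lra.
exists s0; split=> // s us dis.
have : rsum (s0 ++ s) (fun i => Cmod (f i)) <= M.
  apply: Mub; exists (s0 ++ s) => //; rewrite cat_uniq us0 us andbT /=.
  by apply/hasPn => x; apply: dis.
by rewrite rsum_cat; lra.
Qed.

(** Under absolute summability it is enough to exhibit good finite sets beyond any given one; the
    tail bound transfers the estimate to all larger sets. *)
Lemma has_sum_cofinal (I : eqType) (f : I -> C) (a : C) :
  abs_bounded f ->
  (forall eps : R, 0 < eps -> forall s0 : seq I, exists s : seq I,
     [/\ uniq s, {subset s0 <= s} & Cmod (csum s f - a)%C < eps]) ->
  has_sum f a.
Proof.
move=> bf cof eps e0.
have e20 : 0 < eps / 2 by lra.
have [s0 [us0 tail]] := bounded_tail bf e20.
have [s [us s0s hs]] := cof _ e20 s0; exists s => t ut st.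
rewrite (csum_subset f us ut st).
set r := [seq x <- t | x \notin s].
have hr : rsum r (fun i => Cmod (f i)) < eps / 2.
  apply: tail; first exact: filter_uniq.
  by move=> i; rewrite mem_filter => /andP[is_ _]; apply: contra is_; apply: s0s.
have := Cmod_triangle (csum s f - a)%C (csum r f); have := Cmod_csum r f.
rewrite (_ : (csum s f - a + csum r f = csum s f + csum r f - a)%C); last by ring.
lra.
Qed.

(* Tannery's theorem, with [supp n] a finite support of [F n]. *)
Lemma has_sum_dominated (I : eqType) (F : nat -> I -> C) (f : I -> C)
    (b : I -> R) (S : nat -> C) (a : C) (supp : nat -> seq I) :
  (exists B, forall s : seq I, uniq s -> rsum s b <= B) ->
  (forall n i, Cmod (F n i) <= b i) ->
  (forall i (eps : R), 0 < eps -> exists n0, forall n, (n0 <= n)%N ->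
     Cmod (F n i - f i)%C < eps) ->
  (forall n, uniq (supp n)) ->
  (forall n i, i \notin supp n -> F n i = RtoC 0) ->
  (forall n, csum (supp n) (F n) = S n) ->
  (forall eps : R, 0 < eps -> exists n0, forall n, (n0 <= n)%N ->
     Cmod (S n - a)%C < eps) ->
  abs_bounded f /\ has_sum f a.
Proof.
move=> [B hB] Fb Ff us F0 FS Sa.
have b0 i : 0 <= b i by apply: Rle_trans (Fb 0%N i); apply: Cmod_ge_0.
have fb i : Cmod (f i) <= b i.
  apply: Rnot_lt_le => lt.
  have [n0 hn] := Ff i _ (Rlt_Rminus _ _ lt).
  move: (hn n0 (leqnn _)) (Fb n0 i) (Cmod_triangle (F n0 i) (- (F n0 i - f i))%C).
  by rewrite Cmod_opp (_ : (F n0 i + - (F n0 i - f i) = f i)%C); [lra | ring].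
have bf : abs_bounded f.
  exists B => s us'; apply: Rle_trans (hB s us').
  by apply: rsum_le => i _.
split=> //; apply: has_sum_cofinal => // eps e0 s0.
have bb : abs_bounded (fun i => RtoC (b i)).
  exists B => s us'; apply: Rle_trans (hB s us').
  by apply: rsum_le => i _; rewrite Cmod_R Rabs_pos_eq //; lra.
have e40 : 0 < eps / 4 by lra.
have [s1 [us1 tail]] := bounded_tail bb e40.
pose s := undup (s0 ++ s1).
have s01 : {subset s0 <= s} by move=> x xs; rewrite mem_undup mem_cat xs.
have s11 : {subset s1 <= s} by move=> x xs; rewrite mem_undup mem_cat xs orbT.
have us' : uniq s by apply: undup_uniq.
exists s; split=> //.
have [n1 h1] := Sa _ e40.
have [n2 h2] : exists n0, forall n, (n0 <= n)%N ->
    Cmod (csum s (F n) - csum s f)%C < eps / 4.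
  have : forall d, 0 < d -> exists n0, forall n, (n0 <= n)%N ->
    Cmod (csum s (F n) - csum s f)%C < d.
    elim: (s) => [|i r IH] d d0.
      exists 0%N => n _; rewrite /csum !big_nil.
      by rewrite (_ : (0 - 0 = 0)%C); [rewrite Cmod_0 | ring].
    have d20 : 0 < d / 2 by lra.
    have [m1 k1] := IH _ d20; have [m2 k2] := Ff i _ d20.
    exists (maxn m1 m2) => n; rewrite geq_max => /andP[l1 l2].
    move: (k1 n l1) (k2 n l2) (Cmod_triangle (F n i - f i)%C (csum r (F n) - csum r f)%C).
    rewrite /csum !big_cons.
    set x := \big[_/_]_(j <- r) F n j; set y := \big[_/_]_(j <- r) f j.
    by rewrite (_ : (F n i - f i + (x - y) = F n i + x - (f i + y))%C); [lra | ring].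
  by apply.
pose n := maxn n1 n2.
have {}h1 := h1 n (leq_maxl _ _); have {}h2 := h2 n (leq_maxr _ _).
have e1 : S n = csum (undup (s ++ supp n)) (F n).
  rewrite -FS (csum_subset (F n) (us n) (undup_uniq (s ++ supp n))); last first.
    by move=> x xs; rewrite mem_undup mem_cat xs orbT.
  rewrite [X in (_ + X)%C]csum_ext0; first by ring.
  by move=> i; rewrite mem_filter => /andP[/F0].
have sub : {subset s <= undup (s ++ supp n)}.
  by move=> x xs; rewrite mem_undup mem_cat xs.
move: e1; rewrite (csum_subset (F n) us' (undup_uniq _) sub).
set r := [seq x <- _ | _] => e1.
have hr : rsum r (fun i => Cmod (F n i)) < eps / 4.
  apply: Rle_lt_trans (tail r _ _).
  - by apply: rsum_le => i _; rewrite Cmod_R Rabs_pos_eq.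
  - by rewrite filter_uniq // undup_uniq.
  - by move=> i; rewrite mem_filter => /andP[ir _]; apply: contra ir; apply: s11.
have h3 := Cmod_csum r (F n).
(* The error splits into [F n] against [f] on s, [S n] against a, and the part of [supp n] outside
   s, which the tail of the majorant controls. *)
have -> : (csum s f - a = - (csum s (F n) - csum s f) + ((S n - a) + - csum r (F n)))%C.
  by rewrite e1; ring.
move: (Cmod_triangle (- (csum s (F n) - csum s f))%C (S n - a + - csum r (F n))%C).
move: (Cmod_triangle (S n - a)%C (- csum r (F n))%C).
rewrite !Cmod_opp; lra.
Qed.

(** * Products of two unordered sums *)

Lemma csum_allpairs (I J : eqType) (s : seq I) (t : seq J) (f : I -> C)
    (g : J -> C) :
  csum [seq (i, j) | i <- s, j <- t] (fun p => f p.1 * g p.2)%C =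
  (csum s f * csum t g)%C.
Proof.
rewrite /csum big_allpairs big_distrl /=; apply: eq_bigr => i _.
by rewrite big_distrr.
Qed.

Lemma rsum_allpairs (I J : eqType) (s : seq I) (t : seq J) (f : I -> R)
    (g : J -> R) :
  rsum [seq (i, j) | i <- s, j <- t] (fun p => f p.1 * g p.2) =
  rsum s f * rsum t g.
Proof.
rewrite /rsum big_allpairs big_distrl /=; apply: eq_bigr => i _.
by rewrite big_distrr.
Qed.

Lemma subset_allpairs_undup (I J : eqType) (s : seq (I * J)) :
  {subset s <= [seq (i, j) | i <- undup (map fst s), j <- undup (map snd s)]}.
Proof.
move=> [i j] ijs; apply: allpairs_f.
  by rewrite mem_undup; apply/mapP; exists (i, j).
by rewrite mem_undup; apply/mapP; exists (i, j).
Qed.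

Lemma uniq_allpairs_pair (I J : eqType) (s : seq I) (t : seq J) :
  uniq s -> uniq t -> uniq [seq (i, j) | i <- s, j <- t].
Proof. by move=> us ut; apply: allpairs_uniq => // -[i j] [i' j']. Qed.

(** Finite rectangles are cofinal among the finite subsets of I * J, and on a rectangle the partial
    sum factors. *)
Lemma has_sum_prod (I J : eqType) (f : I -> C) (g : J -> C) (a b : C) :
  abs_bounded f -> abs_bounded g -> has_sum f a -> has_sum g b ->
  has_sum (fun p : I * J => f p.1 * g p.2)%C (a * b)%C.
Proof.
move=> [A hA] [B hB] fa gb.
have ab : abs_bounded (fun p : I * J => f p.1 * g p.2)%C.
  exists (A * B) => s us.
  pose s1 := undup (map fst s); pose s2 := undup (map snd s).
  have u1 : uniq s1 by apply: undup_uniq.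
  have u2 : uniq s2 by apply: undup_uniq.
  have := rsum_subset (fun p => Cmod (f p.1 * g p.2)%C) us
    (uniq_allpairs_pair u1 u2) (@subset_allpairs_undup _ _ s).
  set r := rsum [seq _ <- _ | _] _ => e.
  have r0 : 0 <= r by apply: rsum_ge0 => i; apply: Cmod_ge_0.
  have e2 : rsum [seq (i, j) | i <- s1, j <- s2]
      (fun p => Cmod (f p.1 * g p.2)%C) =
    rsum s1 (fun i => Cmod (f i)) * rsum s2 (fun i => Cmod (g i)).
    rewrite -rsum_allpairs; apply: eq_bigr => i _; exact: Cmod_mult.
  have := hA s1 u1; have := hB s2 u2.
  have : 0 <= rsum s1 (fun i => Cmod (f i)) by apply: rsum_ge0 => i; apply: Cmod_ge_0.
  have : 0 <= rsum s2 (fun i => Cmod (g i)) by apply: rsum_ge0 => i; apply: Cmod_ge_0.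
  move: e2; rewrite e; nra.
apply: has_sum_cofinal => // eps e0 s0.
(* The error is at most d^2 + d |b| + |a| d, hence at most d M once d <= 1. *)
pose M := Cmod a + Cmod b + 1.
have a0 := Cmod_ge_0 a; have b0 := Cmod_ge_0 b.
have M0 : 0 < M by rewrite /M; lra.
pose d := Rmin 1 (eps / (2 * M)).
have d0 : 0 < d by apply: Rmin_glb_lt; [lra | apply: Rdiv_lt_0_compat; lra].
have d1 : d <= 1 by apply: Rmin_l.
have dM : d * M < eps.
  apply: (@Rle_lt_trans _ (eps / (2 * M) * M)).
    by apply: Rmult_le_compat_r; [lra | apply: Rmin_r].
  rewrite (_ : eps / (2 * M) * M = eps / 2); [lra | field; lra].
have [s hs] := fa _ d0; have [t ht] := gb _ d0.
pose s' := undup (s ++ map fst s0); pose t' := undup (t ++ map snd s0).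
exists [seq (i, j) | i <- s', j <- t']; split.
- by apply: uniq_allpairs_pair; apply: undup_uniq.
- move=> [i j] ij; apply: allpairs_f; rewrite mem_undup mem_cat;
    by apply/orP; right; apply/mapP; exists (i, j).
rewrite csum_allpairs.
have {}hs : Cmod (csum s' f - a)%C < d.
  by apply: hs; [apply: undup_uniq | move=> x xs; rewrite mem_undup mem_cat xs].
have {}ht : Cmod (csum t' g - b)%C < d.
  by apply: ht; [apply: undup_uniq | move=> x xs; rewrite mem_undup mem_cat xs].
move: hs ht; set x := csum s' f; set y := csum t' g => hx hy.
have -> : (x * y - a * b =
  (x - a) * (y - b) + ((x - a) * b + a * (y - b)))%C by ring.
move: (Cmod_triangle ((x - a) * (y - b))%C ((x - a) * b + a * (y - b))%C).
move: (Cmod_triangle ((x - a) * b)%C (a * (y - b))%C).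
rewrite !Cmod_mult; move: (Cmod_ge_0 (x - a)%C) (Cmod_ge_0 (y - b)%C).
rewrite /M in dM; nra.
Qed.

(** * Infinite products *)

Lemma Ceq_ReIm (x y : C) : Re x = Re y -> Im x = Im y -> x = y.
Proof. by case: x => a b; case: y => c d /= -> ->. Qed.

(** * The complex exponential *)

Lemma cexp_add (x y : C) : cexp (x + y)%C = (cexp x * cexp y)%C.
Proof.
case: x => a b; case: y => c d.
by apply: Ceq_ReIm; rewrite /cexp /= exp_plus ?cos_plus ?sin_plus; ring.
Qed.

Lemma cexp0 : cexp 0%C = 1%C.
Proof. by apply: Ceq_ReIm; rewrite /cexp /= exp_0 ?cos_0 ?sin_0; ring. Qed.

Lemma cexp_oppK (x : C) : (cexp x * cexp (- x))%C = 1%C.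
Proof. by rewrite -cexp_add (_ : (x + - x)%C = 0%C); [exact: cexp0 | ring]. Qed.

Lemma cexp_neq0 (x : C) : cexp x <> 0%C.
Proof.
by move=> e; move: (cexp_oppK x); rewrite e Cmult_0_l => /esym /C1_nz.
Qed.

Lemma cexp_opp (x : C) : cexp (- x)%C = (/ cexp x)%C.
Proof.
have n0 := @cexp_neq0 x.
by rewrite -[cexp (- x)]Cmult_1_l -(Cinv_l _ n0) -Cmult_assoc cexp_oppK Cmult_1_r.
Qed.

Lemma cexp_nat (n : nat) (x : C) : cexp (INR n * x)%C = (cexp x ^ n)%C.
Proof.
elim: n => [|n IH]; first by rewrite Cmult_0_l cexp0.
rewrite Cpow_S -IH -cexp_add S_INR RtoC_plus; congr cexp; ring.
Qed.

Lemma Cmod_cexp (x : C) : Cmod (cexp x) = exp (Re x).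
Proof.
rewrite /Cmod /cexp /=.
have -> : exp (Re x) * cos (Im x) * (exp (Re x) * cos (Im x) * 1) +
  exp (Re x) * sin (Im x) * (exp (Re x) * sin (Im x) * 1) =
  exp (Re x) * exp (Re x) * ((sin (Im x))² + (cos (Im x))²).
  by rewrite /Rsqr; ring.
rewrite sin2_cos2 Rmult_1_r; apply: sqrt_square; apply: Rlt_le; exact: exp_pos.
Qed.

Lemma exp_le_exp (x y : R) : x <= y -> exp x <= exp y.
Proof.
case/Rle_lt_or_eq_dec => [/exp_increasing/Rlt_le //|->]; exact: Rle_refl.
Qed.

(** Componentwise, to match the way [infprod] takes its limits; [Ccv_eps] gives the equivalent form
    with the modulus. *)
Definition Ccv (f : nat -> C) (l : C) : Prop :=
  is_lim_seq (fun n => Re (f n)) (Re l) /\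
  is_lim_seq (fun n => Im (f n)) (Im l).

Lemma Ccv_eps (f : nat -> C) (l : C) : Ccv f l <->
  forall eps : R, 0 < eps -> exists n0, forall n, (n0 <= n)%N ->
    Cmod (f n - l)%C < eps.
Proof.
split=> [[hr hi] eps e0 | h].
  have e20 : 0 < eps / 2 by lra.
  have [n1 h1] := (proj1 (is_lim_seq_Reals _ _) hr) _ e20.
  have [n2 h2] := (proj1 (is_lim_seq_Reals _ _) hi) _ e20.
  exists (maxn n1 n2) => n; rewrite geq_max => /andP[/leP l1 /leP l2].
  have {}h1 := h1 n l1; have {}h2 := h2 n l2; rewrite /R_dist in h1 h2.
  have -> : (f n - l)%C =
      (RtoC (Re (f n) - Re l) + Ci * RtoC (Im (f n) - Im l))%C.
    by apply: Ceq_ReIm; rewrite /Re /Im /=; ring.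
  apply: Rle_lt_trans (Cmod_triangle _ _) _.
  rewrite Cmod_mult Cmod_Ci !Cmod_R; lra.
split; apply/is_lim_seq_Reals => eps e0; have [n0 hn] := h _ e0;
  exists n0 => n /leP /hn hlt; apply: Rle_lt_trans hlt.
  apply: Rle_trans (re_le_Cmod _); right; rewrite /R_dist; congr Rabs => /=; ring.
apply: Rle_trans (Rmax_Cmod _); apply: Rle_trans (Rmax_r _ _).
by right; rewrite /R_dist; congr Rabs => /=; ring.
Qed.

Lemma Ccv_unique (f : nat -> C) (a b : C) : Ccv f a -> Ccv f b -> a = b.
Proof.
move=> [ra ia] [rb ib]; apply: Ceq_ReIm.
  by have := is_lim_seq_unique _ _ ra; rewrite (is_lim_seq_unique _ _ rb) => -[].
by have := is_lim_seq_unique _ _ ia; rewrite (is_lim_seq_unique _ _ ib) => -[].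
Qed.

Lemma Ccv_ext (f g : nat -> C) (a : C) :
  (forall n, f n = g n) -> Ccv f a -> Ccv g a.
Proof.
by move=> fg [h1 h2]; split; [apply: is_lim_seq_ext h1 | apply: is_lim_seq_ext h2];
  move=> n /=; rewrite fg.
Qed.

Lemma Ccv_const (a : C) : Ccv (fun _ => a) a.
Proof. by split; apply: is_lim_seq_const. Qed.

Lemma Ccv_mult (f g : nat -> C) (a b : C) :
  Ccv f a -> Ccv g b -> Ccv (fun n => f n * g n)%C (a * b)%C.
Proof.
move=> [h1 h2] [h3 h4]; split; rewrite /=.
  apply: is_lim_seq_minus'; apply: is_lim_seq_mult' => //.
apply: is_lim_seq_plus'; apply: is_lim_seq_mult' => //.
Qed.

Lemma Ccv_subseq (f : nat -> C) (a : C) (phi : nat -> nat) :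
  (forall m, exists n0, forall n, (n0 <= n)%N -> (m <= phi n)%N) ->
  Ccv f a -> Ccv (fun n => f (phi n)) a.
Proof.
move=> hphi /Ccv_eps h; apply/Ccv_eps => eps e0; have [m hm] := h _ e0.
by have [n0 hn] := hphi m; exists n0 => n /hn; apply: hm.
Qed.

Fixpoint cprod (f : nat -> C) (n : nat) : C :=
  if n is n'.+1 then (cprod f n' * f n')%C else 1%C.

Lemma cprodS (f : nat -> C) (n : nat) : cprod f n.+1 = (cprod f n * f n)%C.
Proof. by []. Qed.

Lemma eq_cprod (f g : nat -> C) (n : nat) :
  (forall k, f k = g k) -> cprod f n = cprod g n.
Proof. by move=> fg; elim: n => //= n ->; rewrite fg. Qed.

Lemma cprod_mul (f g : nat -> C) (n : nat) :
  cprod (fun k => f k * g k)%C n = (cprod f n * cprod g n)%C.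
Proof. by elim: n => [|n IH] /=; [ring | rewrite IH; ring]. Qed.

Lemma cprod_addn (f : nat -> C) (m n : nat) :
  cprod f (m + n) = (cprod f m * cprod (fun k => f (m + k)%N) n)%C.
Proof.
elim: n => [|n IH]; first by rewrite addn0 /=; ring.
by rewrite addnS /= IH; ring.
Qed.

Lemma cprod_recl (f : nat -> C) (n : nat) :
  cprod f n.+1 = (f 0%N * cprod (fun k => f k.+1) n)%C.
Proof.
elim: n => [|n IH]; first by rewrite /=; ring.
by rewrite [LHS](_ : _ = cprod f n.+1 * f n.+1)%C // IH /=; ring.
Qed.

Lemma cprod_rev (f : nat -> C) (n : nat) :
  cprod f n = cprod (fun k => f (n - k.+1)%N) n.
Proof.
elim: n => // n IH; rewrite [RHS]cprod_recl subn1 /= IH Cmult_comm.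
by congr Cmult; apply: eq_cprod => k; rewrite subSS.
Qed.

Lemma pprod_cprod (f : nat -> C) (n : nat) : pprod f n = cprod f n.
Proof.
rewrite /pprod.
suff h m : List.fold_right (fun k acc => f k * acc)%C (RtoC 1) (List.seq m n) =
    cprod (fun k => f (m + k)%N) n.
  by rewrite h; apply: eq_cprod.
elim: n m => // n IH m; rewrite cprod_recl /= IH addn0; congr Cmult.
by apply: eq_cprod => k; rewrite addSnnS.
Qed.

Lemma infprod_unique (f : nat -> C) (l : C) :
  Ccv (cprod f) l -> infprod f = l.
Proof.
move=> [h1 h2]; apply: Ceq_ReIm; rewrite /infprod /=.
  rewrite (is_lim_seq_unique _ (Re l)) //.
  by apply: is_lim_seq_ext h1 => n; rewrite pprod_cprod.
rewrite (is_lim_seq_unique _ (Im l)) //.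
by apply: is_lim_seq_ext h2 => n; rewrite pprod_cprod.
Qed.

(** Each factor satisfies |1 + u_k| <= exp (K r^k). The induction carries the exact finite geometric
    sum in the exponent, which is bounded only at the end. *)
Lemma cprod_bound (u : nat -> C) (K r : R) :
  0 <= K -> 0 <= r < 1 -> (forall k, Cmod (u k) <= K * r ^ k) ->
  forall n, Cmod (cprod (fun k => 1 + u k)%C n) <= exp (K / (1 - r)).
Proof.
move=> K0 r01 hu n.
have h : Cmod (cprod (fun k => 1 + u k)%C n) <= exp (K * (1 - r ^ n) / (1 - r)).
  elim: n => [|n IH].
    rewrite /= Cmod_1 (_ : K * (1 - 1) / (1 - r) = 0); last by field; lra.
    by rewrite exp_0; lra.
  rewrite [cprod _ _]/= Cmod_mult.
  have -> : K * (1 - r ^ n.+1) / (1 - r) = K * (1 - r ^ n) / (1 - r) + K * r ^ n.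
    by rewrite /=; field; lra.
  rewrite exp_plus; apply: Rmult_le_compat => //; try exact: Cmod_ge_0.
  have h1 := Cmod_triangle 1%C (u n); rewrite Cmod_1 in h1.
  have := exp_ineq1_le (K * r ^ n); have := hu n; lra.
apply: Rle_trans h _.
have rn : 0 <= r ^ n by apply: pow_le; lra.
apply: exp_le_exp; apply: Rmult_le_compat_r; last by nra.
by apply: Rlt_le; apply: Rinv_0_lt_compat; lra.
Qed.

(** Telescoping: consecutive partial products differ by P_k u_k, and since the P_k are bounded these
    differences are dominated by a geometric series. *)
Lemma cprod_cv (u : nat -> C) (K r : R) :
  0 <= K -> 0 <= r < 1 -> (forall k, Cmod (u k) <= K * r ^ k) ->
  exists l, Ccv (cprod (fun k => 1 + u k)%C) l.
Proof.
move=> K0 r01 hu.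
have hb := cprod_bound K0 r01 hu.
set P := cprod _ in hb *; set M := exp _ in hb.
have M0 : 0 <= M by apply: Rlt_le; apply: exp_pos.
have dP k : Cmod (P k * u k)%C <= M * K * r ^ k.
  rewrite Cmod_mult Rmult_assoc; apply: Rmult_le_compat => //; exact: Cmod_ge_0.
have geo : ex_series (fun k => M * K * r ^ k).
  by apply: ex_series_scal_l; exists (/ (1 - r)); apply: is_series_geom;
    rewrite Rabs_pos_eq; lra.
have key (p : C -> R) :
    (forall x y, p (x + y)%C = p x + p y) -> (forall x, Rabs (p x) <= Cmod x) ->
    exists l : R, is_lim_seq (fun n => p (P n)) l.
  move=> padd pabs.
  have [l hl] : ex_series (fun k => p (P k * u k)%C).
    apply: ex_series_le geo => k; exact: Rle_trans (pabs _) (dP k).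
  (* [sum_n] up to n has n + 1 terms and telescopes to P_(n+1) - P_0 with P_0 = 1, whence the shift
     and the constant [p 1]. *)
  exists (l + p 1%C); apply/is_lim_seq_incr_1.
  apply: (is_lim_seq_ext (fun n => sum_n (fun k => p (P k * u k)%C) n + p 1%C)).
    elim=> [|n IH].
      rewrite sum_O /= -padd; congr p; rewrite /P /=; ring.
    rewrite sum_Sn /plus /= [X in X + _]Rplus_comm Rplus_assoc IH -padd.
    by congr p; rewrite /P /=; ring.
  apply: is_lim_seq_plus' => //; exact: is_lim_seq_const.
have [||a ha] := key Re; [by [] | exact: re_le_Cmod |].
have [||b hb'] := key Im; [by [] | |].
  by move=> x; apply: Rle_trans (Rmax_Cmod _); apply: Rmax_r.
by exists (a, b).
Qed.

(** * The Jacobi triple product *)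

Definition qfac (q : C) (n : nat) : C := cprod (fun k => 1 - q ^ k.+1)%C n.
Definition euler (q : C) : C := infprod (fun k => 1 - q ^ k.+1)%C.

Lemma Cmod_pow_le (q : C) (k : nat) : Cmod q < 1 -> Cmod (q ^ k.+1)%C <= Cmod q.
Proof.
move=> q1; have q0 := Cmod_ge_0 q.
elim: k => [|k IH]; first by rewrite Cpow_1_r; lra.
by rewrite Cpow_S Cmod_mult; nra.
Qed.

Lemma Cmod_one_minus_pow (q : C) (k : nat) : Cmod q < 1 ->
  1 - Cmod q <= Cmod (1 - q ^ k.+1)%C.
Proof.
move=> q1; have h := Cmod_pow_le k q1.
have := Cmod_triangle (1 - q ^ k.+1)%C (q ^ k.+1)%C.
by rewrite (_ : (1 - q ^ k.+1 + q ^ k.+1)%C = 1%C) ?Cmod_1; [lra | ring].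
Qed.

Lemma one_minus_pow_neq0 (q : C) (k : nat) : Cmod q < 1 -> (1 - q ^ k.+1)%C <> 0%C.
Proof.
by move=> q1 e; have := Cmod_one_minus_pow k q1; rewrite e Cmod_0; lra.
Qed.

Lemma qfac_neq0 (q : C) (n : nat) : Cmod q < 1 -> qfac q n <> 0%C.
Proof.
move=> q1; elim: n => [|n IH]; first exact: C1_nz.
by apply: Cmult_neq_0 => //; apply: one_minus_pow_neq0.
Qed.

Lemma qfacS (q : C) (n : nat) : qfac q n.+1 = (qfac q n * (1 - q ^ n.+1))%C.
Proof. by []. Qed.

Lemma cprod_pow_cv (q z : C) : Cmod q < 1 ->
  exists l, Ccv (cprod (fun k => 1 + z * q ^ k)%C) l.
Proof.
move=> q1; have q0 := Cmod_ge_0 q.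
apply: (@cprod_cv _ (Cmod z) (Cmod q)); [exact: Cmod_ge_0 | by [] |].
by move=> k; rewrite Cmod_mult Cmod_pow; lra.
Qed.

Lemma euler_cv (q : C) : Cmod q < 1 -> Ccv (qfac q) (euler q).
Proof.
move=> q1; have [l hl] := cprod_pow_cv (- q)%C q1.
have {}hl : Ccv (qfac q) l.
  by apply: Ccv_ext hl => n; apply: eq_cprod => k; rewrite Cpow_S; ring.
by rewrite /euler (infprod_unique hl).
Qed.

(** Nonvanishing comes from the reciprocal product: 1 / (1 - x) = 1 + x / (1 - x) with x = q^(k+1)
    is again a factor with geometric decay, so the reciprocals converge and their limit times
    [euler q] is 1. *)
Lemma euler_inv_cv (q : C) : Cmod q < 1 ->
  euler q <> 0%C /\ Ccv (fun n => / qfac q n)%C (/ euler q)%C.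
Proof.
move=> q1; have q0 := Cmod_ge_0 q.
have [||k|l hl] := @cprod_cv (fun k => q ^ k.+1 / (1 - q ^ k.+1))%C
    (/ (1 - Cmod q)) (Cmod q).
- by apply: Rlt_le; apply: Rinv_0_lt_compat; lra.
- by [].
- have n0 := @one_minus_pow_neq0 q k q1.
  have h := @Cmod_one_minus_pow q k q1.
  rewrite Cmod_div // /Rdiv [X in X <= _]Rmult_comm; apply: Rmult_le_compat.
  + by apply: Rlt_le; apply: Rinv_0_lt_compat; lra.
  + exact: Cmod_ge_0.
  + by apply: Rinv_le_contravar; lra.
  + rewrite Cmod_pow /=; have := pow_le _ k q0; nra.
have {}hl : Ccv (fun n => / qfac q n)%C l.
  apply: Ccv_ext hl; elim=> [|n IH].
    by rewrite /qfac /=; field; exact: C1_nz.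
  rewrite qfacS [LHS]/= IH Cpow_S; field.
  by split; [apply: one_minus_pow_neq0 | apply: qfac_neq0].
have e1 : (euler q * l = 1)%C.
  apply: (Ccv_unique (Ccv_mult (euler_cv q1) hl)).
  by apply: Ccv_ext (Ccv_const 1%C) => n; field; apply: qfac_neq0.
have n0 : euler q <> 0%C.
  by move=> e; move: e1; rewrite e Cmult_0_l => /esym /C1_nz.
split=> //; suff -> : (/ euler q)%C = l by [].
by rewrite -[RHS]Cmult_1_l -(Cinv_l _ n0) -Cmult_assoc e1 Cmult_1_r.
Qed.

(** * Gaussian binomial coefficients and the finite triple product *)

Definition qbin (q : C) (m j : nat) : C := (qfac q m / (qfac q j * qfac q (m - j)))%C.

Lemma qbinE (q : C) (m j : nat) : Cmod q < 1 ->
  qbin q m j = (qfac q m * (/ qfac q j * / qfac q (m - j)))%C.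
Proof. by move=> q1; rewrite /qbin; field; split; apply: qfac_neq0. Qed.

(** The upper index is written j + (p + 1) so that no natural subtraction truncates; p + 1 is the
    usual m - j. *)
Lemma qbin_pascal (q : C) (j p : nat) : Cmod q < 1 ->
  (qbin q (j + p.+1).+1 j.+1 = qbin q (j + p.+1) j.+1 + q ^ p.+1 * qbin q (j + p.+1) j)%C.
Proof.
move=> q1; rewrite /qbin.
rewrite (_ : (j + p.+1).+1 - j.+1 = p.+1)%N; last by lia.
rewrite (_ : (j + p.+1) - j.+1 = p)%N; last by lia.
rewrite (_ : (j + p.+1) - j = p.+1)%N; last by lia.
rewrite !qfacS.
rewrite (_ : (j + p.+1).+1 = (j.+1 + p.+1)%coq_nat) ?Cpow_add_r; last by lia.
have h1 := @qfac_neq0 q j q1; have h2 := @qfac_neq0 q p q1.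
have h3 := @one_minus_pow_neq0 q j q1; have h4 := @one_minus_pow_neq0 q p q1.
move: h3 h4; set a := (q ^ j.+1)%C; set b := (q ^ p.+1)%C => h3 h4.
by field; repeat split.
Qed.

Lemma qbin0 (q : C) (m : nat) : Cmod q < 1 -> qbin q m 0 = 1%C.
Proof.
move=> q1; rewrite /qbin subn0 /=; have h := @qfac_neq0 q m q1.
by rewrite (_ : qfac q 0 = 1%C) //; field.
Qed.

Lemma qbinn (q : C) (m : nat) : Cmod q < 1 -> qbin q m m = 1%C.
Proof.
move=> q1; rewrite /qbin subnn /=; have h := @qfac_neq0 q m q1.
by rewrite (_ : qfac q 0 = 1%C) //; field.
Qed.

(** The new factor 1 + x q^m matches the Pascal rule, because 'C(j+1, 2) = 'C(j, 2) + j gives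
    q^(m-j) q^'C(j+1, 2) = q^m q^'C(j, 2). *)
Lemma q_binomial (q x : C) (m : nat) : Cmod q < 1 ->
  cprod (fun k => 1 + x * q ^ k)%C m =
  \big[Cplus/RtoC 0]_(0 <= j < m.+1) (qbin q m j * q ^ 'C(j, 2) * x ^ j)%C.
Proof.
move=> q1; elim: m => [|m IH].
  by rewrite big_nat1 qbin0 //= ?bin0n /=; ring.
rewrite [LHS]/= IH [RHS]big_nat_recl // [X in _ = (_ + X)%C]big_nat_recr //.
set a := (fun j => qbin q m j * q ^ 'C(j, 2) * x ^ j)%C.
have -> : \big[Cplus/RtoC 0]_(0 <= i < m)
    (qbin q m.+1 i.+1 * q ^ 'C(i.+1, 2) * x ^ i.+1)%C =
  \big[Cplus/RtoC 0]_(0 <= i < m) (a i.+1 + (x * q ^ m) * a i)%C.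
  rewrite !big_nat; apply: eq_bigr => i /andP[_ im].
  have [p mp] : exists p, m = (i + p.+1)%N by exists (m - i.+1)%N; lia.
  rewrite /a mp qbin_pascal // binS bin1.
  rewrite (_ : 'C(i, 2) + i = ('C(i, 2) + i)%coq_nat)%N // Cpow_add_r.
  rewrite (_ : i + p.+1 = (i + p.+1)%coq_nat)%N // !Cpow_add_r !Cpow_S; ring.
rewrite big_split /= -big_distrr /=.
have e1 : \big[Cplus/RtoC 0]_(0 <= j < m.+1) a j =
  (a 0%N + \big[Cplus/RtoC 0]_(0 <= i < m) a i.+1)%C by rewrite big_nat_recl.
have e2 : \big[Cplus/RtoC 0]_(0 <= j < m.+1) a j =
  (\big[Cplus/RtoC 0]_(0 <= i < m) a i + a m)%C by rewrite big_nat_recr.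
rewrite CmultDr Cmult_1_r {1}e1 e2 /a !qbin0 // !qbinn // binS bin1 ?bin0n /=.
rewrite (_ : 'C(m, 2) + m = ('C(m, 2) + m)%coq_nat)%N // Cpow_add_r; ring.
Qed.

Definition jtp_factor (q z : C) (k : nat) : C :=
  ((1 - q ^ k.+1) * (1 + z * q ^ k.+1) * (1 + / z * q ^ k))%C.
(** Here s and w are logarithms of q and z, so the term is q^(n(n+1)/2) z^n for every integer n. *)
Definition jtp_term (s w : C) (n : Z) : C :=
  cexp (IZR (n * (n + 1)) / 2 * s + IZR n * w)%C.

Lemma jtp_cv (q z : C) : Cmod q < 1 -> exists l, Ccv (cprod (jtp_factor q z)) l.
Proof.
move=> q1; have [a ha] := cprod_pow_cv (z * q)%C q1.
have [b hb] := cprod_pow_cv (/ z)%C q1.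
exists (euler q * a * b)%C.
apply: Ccv_ext (Ccv_mult (Ccv_mult (euler_cv q1) ha) hb) => n.
rewrite -!cprod_mul; apply: eq_cprod => k; rewrite /jtp_factor !Cpow_S; ring.
Qed.

Lemma eq_cprod_lt (f g : nat -> C) (n : nat) :
  (forall k, (k < n)%N -> f k = g k) -> cprod f n = cprod g n.
Proof.
elim: n => //= n IH fg; rewrite IH ?fg // => k kn; apply: fg; exact: ltnW.
Qed.

Lemma INR_bin2 (j : nat) : INR 'C(j, 2) = INR j * (INR j - 1) / 2.
Proof.
elim: j => [|j IH]; first by rewrite /=; field.
by rewrite binS bin1 plus_INR IH S_INR; field.
Qed.

Lemma cprod_cexp (s w : C) (n : nat) :
  cprod (fun k => cexp (w - INR k * s)%C) n =
  cexp (INR n * w - INR n * (INR n - 1) / 2 * s)%C.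
Proof.
elim: n => [|n IH].
  by rewrite /= -[LHS]cexp0; congr cexp; field.
by rewrite [LHS]/= IH -cexp_add S_INR RtoC_plus; congr cexp; field.
Qed.

(* The q-binomial theorem with 2n factors at x = z q^(1-n), recentred at the
   middle index n. *)
Lemma jtp_finite (s w : C) (n : nat) : Cmod (cexp s) < 1 ->
  cprod (fun k => (1 + cexp w * cexp s ^ k.+1) * (1 + / cexp w * cexp s ^ k))%C n =
  \big[Cplus/RtoC 0]_(0 <= j < (n + n).+1)
    (qbin (cexp s) (n + n) j * jtp_term s w (Z.of_nat j - Z.of_nat n))%C.
Proof.
move=> q1.
pose x := cexp (w + (1 - INR n) * s)%C.
have := q_binomial x (n + n) q1.
rewrite cprod_addn (cprod_rev _ n).
have -> : cprod (fun k => 1 + x * cexp s ^ (n + k))%C n =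
    cprod (fun k => 1 + cexp w * cexp s ^ k.+1)%C n.
  apply: eq_cprod => k; congr Cplus.
  rewrite /x -!cexp_nat -!cexp_add S_INR plus_INR !RtoC_plus; congr cexp; ring.
(* In the lower half, read backwards, the factor is 1 + z q^(-k) = z q^(-k) (1 + q^k / z); the
   monomials are collected in front. *)
have -> : cprod (fun k => 1 + x * cexp s ^ (n - k.+1))%C n =
    (cexp (INR n * w - INR n * (INR n - 1) / 2 * s) *
     cprod (fun k => 1 + / cexp w * cexp s ^ k) n)%C.
  rewrite -cprod_cexp -cprod_mul; apply: eq_cprod_lt => k kn.
  rewrite /x -!cexp_nat -cexp_opp CmultDr -!cexp_add Cmult_1_r.
  rewrite minus_INR; last by lia.
  rewrite S_INR !RtoC_minus RtoC_plus [RHS]Cplus_comm -[X in (X + _ = _)%C]cexp0.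
  by congr (cexp _ + cexp _)%C; ring.
set e := (INR n * w - _)%C => h.
have -> : cprod (fun k => (1 + cexp w * cexp s ^ k.+1) *
    (1 + / cexp w * cexp s ^ k))%C n =
  (cexp (- e) * (cexp e * cprod (fun k => 1 + / cexp w * cexp s ^ k) n *
    cprod (fun k => 1 + cexp w * cexp s ^ k.+1) n))%C.
  have h2 := cexp_oppK e.
  rewrite cprod_mul -[LHS]Cmult_1_l -h2; ring.
rewrite h big_distrr; apply: eq_bigr => j _ /=.
rewrite /jtp_term -!cexp_nat.
rewrite (_ : (cexp (- e) * (qbin (cexp s) (n + n) j *
    cexp (INR 'C(j, 2) * s) * cexp (INR j * (w + (1 - INR n) * s))) =
  qbin (cexp s) (n + n) j * (cexp (- e) *
    cexp (INR 'C(j, 2) * s) * cexp (INR j * (w + (1 - INR n) * s))))%C); last by ring.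
congr Cmult; rewrite -!cexp_add; congr cexp.
rewrite INR_bin2 mult_IZR plus_IZR minus_IZR -!INR_IZR_INZ /e.
rewrite ?(RtoC_mult, RtoC_div, RtoC_minus, RtoC_plus); try lra.
by field.
Qed.

Lemma rsum_geom (r : R) (n : nat) : 0 <= r < 1 ->
  rsum (iota 0 n) (fun k => r ^ k) <= / (1 - r).
Proof.
move=> r01.
have -> : rsum (iota 0 n) (fun k => r ^ k) = (1 - r ^ n) / (1 - r).
  elim: n => [|n IH]; first by rewrite /rsum big_nil /=; field; lra.
  rewrite -addn1 iotaD rsum_cat IH /rsum big_seq1 add0n addn1 /=; field; lra.
have := pow_le r n (proj1 r01).
have := Rinv_0_lt_compat (1 - r); rewrite /Rdiv; nra.
Qed.

Lemma rsum_exp_abs_bounded : exists B, forall s : seq Z, uniq s ->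
  rsum s (fun n => exp (- IZR (Z.abs n))) <= B.
Proof.
pose r := exp (-1).
have r01 : 0 <= r < 1.
  split; first by apply: Rlt_le; apply: exp_pos.
  by rewrite -exp_0; apply: exp_increasing; lra.
have er k : exp (- INR k) = r ^ k.
  elim: k => [|k IH]; first by rewrite /= Ropp_0 exp_0.
  by rewrite S_INR /= -IH /r -exp_plus; congr exp; ring.
exists (/ (1 - r) + / (1 - r)) => s us.
have [m hm] : exists m : nat, forall n : Z, n \in s -> (Z.abs n < Z.of_nat m)%Z.
  elim: (s) => [|a t [m hm]]; first by exists 0%N.
  exists (m + (Z.abs_nat a).+1)%N => n; rewrite inE => /orP[/eqP ->|/hm]; lia.
pose t := [seq Z.of_nat k | k <- iota 0 m] ++ [seq - Z.of_nat k.+1 | k <- iota 0 m]%Z.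
have ut : uniq t.
  rewrite cat_uniq !map_inj_uniq ?iota_uniq //=; try by move=> x y; lia.
  by rewrite andbT; apply/hasPn => x /mapP[k _ ->]; apply/negP => /mapP[l _]; lia.
have st : {subset s <= t}.
  move=> x /hm hx; rewrite mem_cat; apply/orP.
  case: (Z_lt_dec x 0) => x0; [right | left]; apply/mapP.
    by exists (Z.abs_nat x).-1; [rewrite mem_iota; lia | lia].
  by exists (Z.abs_nat x); [rewrite mem_iota; lia | lia].
have := rsum_subset (fun n => exp (- IZR (Z.abs n))) us ut st.
set z := rsum [seq _ <- _ | _] _ => e.
have z0 : 0 <= z by apply: rsum_ge0 => i; apply: Rlt_le; apply: exp_pos.
have : rsum t (fun n => exp (- IZR (Z.abs n))) <= / (1 - r) + / (1 - r).
  rewrite rsum_cat; apply: Rplus_le_compat;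
    rewrite /rsum big_map; apply: Rle_trans (rsum_geom m r01);
    apply: rsum_le => k _.
    by rewrite -er INR_IZR_INZ; right; congr (exp (- IZR _)); lia.
  rewrite -er INR_IZR_INZ -!opp_IZR.
  have : (IZR (- Z.abs (- Z.of_nat k.+1)) < IZR (- Z.of_nat k)) by apply: IZR_lt; lia.
  by move/exp_increasing; lra.
rewrite e => h; apply: Rle_trans h; rewrite -[X in X <= _]Rplus_0_r; exact: Rplus_le_compat_l.
Qed.

(** The negative quadratic part of the exponent beats the linear part. The coefficient of |n| is at
    most b - 1, completing the square absorbs b |n| at the cost of b^2 / (2 (- Re s)), and the
    remaining -|n| is the decay. *)
Lemma jtp_term_bound (s w : C) : Re s < 0 -> exists K, 0 <= K /\
  forall n, Cmod (jtp_term s w n) <= K * exp (- IZR (Z.abs n)).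
Proof.
move=> s0; pose b := Rabs (Re w) - Re s / 2 + 1.
exists (exp (b * b / (2 * - Re s))); split.
  by apply: Rlt_le; apply: exp_pos.
move=> n; rewrite /jtp_term Cmod_cexp -exp_plus.
have -> : Re (IZR (n * (n + 1)) / 2 * s + IZR n * w)%C =
    IZR n * (IZR n + 1) / 2 * Re s + IZR n * Re w.
  by rewrite mult_IZR plus_IZR /Re /=; field.
apply: exp_le_exp; rewrite abs_IZR.
set x := IZR n; set t := Re s in s0 b *; set v := Re w in b *.
have h1 : x * v <= Rabs x * Rabs v.
  by rewrite -Rabs_mult; apply: Rle_abs.
have h2 : - x <= Rabs x by rewrite -Rabs_Ropp; apply: Rle_abs.
have h3 : x * x = Rabs x * Rabs x by rewrite -Rabs_mult Rabs_pos_eq //; nra.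
have h4 : 0 <= b * b / (2 * - t) + Rabs x * Rabs x / 2 * - t - b * Rabs x.
  have -> : b * b / (2 * - t) + Rabs x * Rabs x / 2 * - t - b * Rabs x =
    (b - Rabs x * - t) * (b - Rabs x * - t) / (2 * - t) by field; lra.
  apply: Rmult_le_pos; first by exact: Rle_0_sqr.
  by apply: Rlt_le; apply: Rinv_0_lt_compat; lra.
have h5 : x * (x + 1) / 2 * t <= (Rabs x * Rabs x - Rabs x) / 2 * t.
  have : 0 <= (x + Rabs x) * - t by apply: Rmult_le_pos; lra.
  nra.
move: h4; set c := b * b / _; rewrite /b; nra.
Qed.

Lemma Ccv_bounded (f : nat -> C) (l : C) : Ccv f l ->
  exists M, 0 <= M /\ forall n, Cmod (f n) <= M.
Proof.
move=> /Ccv_eps /(_ 1 Rlt_0_1) [n0 hn].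
have [A hA] : exists A, forall n, (n < n0)%N -> Cmod (f n) <= A.
  elim: (n0) => [|m [A hA]]; first by exists 0.
  exists (Rmax A (Cmod (f m))) => n; rewrite ltnS leq_eqVlt => /orP[/eqP ->|/hA h].
    exact: Rmax_r.
  exact: Rle_trans (Rmax_l _ _).
have hB n : Cmod (f n) <= Rmax A (Cmod l + 1).
  case: (ltnP n n0) => [/hA h|/hn h]; first exact: Rle_trans (Rmax_l _ _).
  apply: Rle_trans (Rmax_r _ _).
  have := Cmod_triangle (f n - l)%C l.
  by rewrite (_ : (f n - l + l)%C = f n); [lra | ring].
by exists (Rmax A (Cmod l + 1)); split=> //; apply: Rle_trans (hB 0%N); apply: Cmod_ge_0.
Qed.

(** Tannery's theorem applied to the finite identity multiplied by (q; q)_n: the coefficient of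
    index i, (q; q)_n times the Gaussian binomial of n + i in 2n, is bounded and tends to 1. The
    limit l is a parameter so that closed forms can be supplied later. *)
Lemma jacobi_triple_product (s w l : C) : Re s < 0 ->
  Ccv (cprod (jtp_factor (cexp s) (cexp w))) l ->
  abs_bounded (jtp_term s w : Z -> C) /\ has_sum (jtp_term s w : Z -> C) l.
Proof.
move=> s0 hl; set q := cexp s in hl *; set z := cexp w in hl *.
have q1 : Cmod q < 1.
  by rewrite Cmod_cexp -exp_0; apply: exp_increasing.
have hE := euler_cv q1; have [E0 hE'] := euler_inv_cv q1.
have [A [A0 hA]] := Ccv_bounded hE; have [A' [A'0 hA']] := Ccv_bounded hE'.
have [K [K0 hK]] := jtp_term_bound w s0.
have [B hB] := rsum_exp_abs_bounded.
pose c n (i : Z) := (qfac q n * qbin q (n + n) (Z.to_nat (Z.of_nat n + i)))%C.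
(* The guard |i| <= n keeps n + i between 0 and 2n, where [Z.to_nat] and [qbin] have their intended
   values. *)
pose F n (i : Z) :=
  if (Z.abs i <=? Z.of_nat n)%Z then (c n i * jtp_term s w i)%C else RtoC 0.
pose supp n := [seq (Z.of_nat j - Z.of_nat n)%Z | j <- iota 0 (n + n).+1].
pose M := A * (A * (A' * A')) * K.
have M0 : 0 <= M by rewrite /M; repeat apply: Rmult_le_pos.
apply: (has_sum_dominated (F := F) (b := fun i => M * exp (- IZR (Z.abs i)))
  (S := cprod (jtp_factor q z)) (supp := supp)).
- exists (M * B) => t ut.
  have -> : rsum t (fun i : Z => M * exp (- IZR (Z.abs i))) =
    M * rsum t (fun i => exp (- IZR (Z.abs i))) by rewrite /rsum big_distrr.
  by apply: Rmult_le_compat_l => //; apply: hB.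
- move=> n i; rewrite /F; case: ifP => _; last first.
    by rewrite Cmod_0; apply: Rmult_le_pos => //; apply: Rlt_le; apply: exp_pos.
  rewrite Cmod_mult /M Rmult_assoc; apply: Rmult_le_compat => //; try exact: Cmod_ge_0.
  rewrite /c qbinE // !Cmod_mult.
  by repeat (apply: Rmult_le_compat => //; try exact: Cmod_ge_0;
    try (apply: Rmult_le_pos; exact: Cmod_ge_0));
    repeat apply: Rmult_le_pos; exact: Cmod_ge_0.
- move=> i.
  have hc : Ccv (fun n => c n i) 1%C.
    (* The four factors are the limits of (q; q)_n, (q; q)_2n and the reciprocals of (q; q)_(n+i)
       and (q; q)_(n-i). *)
    have -> : RtoC 1 = (euler q * (euler q * (/ euler q * / euler q)))%C by field.
    apply: Ccv_ext (Ccv_mult hE (Ccv_mult (Ccv_subseq (phi := fun n => n + n)%N _ hE)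
      (Ccv_mult (Ccv_subseq (phi := fun n => Z.to_nat (Z.of_nat n + i)) _ hE')
        (Ccv_subseq (phi := fun n => n + n - Z.to_nat (Z.of_nat n + i))%N _ hE')))).
    + by move=> n; rewrite /c qbinE.
    + by move=> m; exists m => n; lia.
    + by move=> m; exists (m + Z.abs_nat i)%N => n; lia.
    + by move=> m; exists (m + Z.abs_nat i)%N => n; lia.
  have /Ccv_eps hF := Ccv_mult hc (Ccv_const (jtp_term s w i)).
  move=> eps /hF [n0 hn]; exists (n0 + Z.abs_nat i)%N => n hle.
  rewrite /F (_ : (Z.abs i <=? Z.of_nat n)%Z = true); last by lia.
  by rewrite -{2}(Cmult_1_l (jtp_term s w i)); apply: hn; lia.
- by move=> n; rewrite map_inj_uniq ?iota_uniq // => x y; lia.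
- move=> n i hi; rewrite /F; case: ifP => // hle; case/negP: hi.
  apply/mapP; exists (Z.to_nat (Z.of_nat n + i)); last by lia.
  by rewrite mem_iota; lia.
- move=> n.
  have -> : cprod (jtp_factor q z) n = (qfac q n *
      cprod (fun k => (1 + z * q ^ k.+1) * (1 + / z * q ^ k)) n)%C.
    by rewrite -cprod_mul; apply: eq_cprod => k; rewrite /jtp_factor; ring.
  rewrite jtp_finite // big_distrr /csum big_map.
  rewrite /index_iota subn0 !big_seq; apply: eq_bigr => j; rewrite mem_iota => hj.
  rewrite /F (_ : (Z.abs _ <=? _)%Z = true); last by lia.
  rewrite /c (_ : Z.to_nat (Z.of_nat n + (Z.of_nat j - Z.of_nat n)) = j); last by lia.
  by rewrite /= Cmult_assoc.
- exact/Ccv_eps.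
Qed.

(** * Product evaluations *)

Lemma Cmod_Cpow_lt1 (q : C) (k : nat) : Cmod q < 1 -> Cmod (q ^ k.+1)%C < 1.
Proof. by move=> q1; apply: Rle_lt_trans (Cmod_pow_le k q1) q1. Qed.

Lemma euler_neq0 (q : C) : Cmod q < 1 -> euler q <> 0%C.
Proof. by move=> q1; case: (euler_inv_cv q1). Qed.

(** Factorwise, (1 + x) (1 - x) = 1 - x^2. *)
Lemma plus_pow_cv (q : C) : Cmod q < 1 ->
  Ccv (cprod (fun k => 1 + q ^ k.+1)%C) (euler (q ^ 2) / euler q)%C.
Proof.
move=> q1; have q21 := Cmod_Cpow_lt1 1 q1; have [_ hi] := euler_inv_cv q1.
apply: Ccv_ext (Ccv_mult (euler_cv q21) hi) => n.
have -> : qfac (q ^ 2) n = (cprod (fun k => 1 + q ^ k.+1) n * qfac q n)%C.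
  rewrite -cprod_mul; apply: eq_cprod => k.
  by rewrite -Cpow_mult_r multE mulnC -multE Cpow_mult_r; ring.
by field; apply: qfac_neq0.
Qed.

Lemma Ccv_shift (f : nat -> C) (l : C) : Ccv f l -> Ccv (fun n => f n.+1) l.
Proof. by apply: (Ccv_subseq (phi := S)) => m; exists m => n; lia. Qed.

(** At z = 1 the third factor starts at 1 + q^0 = 2. Splitting it off leaves the product of the 1 +
    q^k twice, with one index shift between the two copies. *)
Lemma jtp_lim1 (q : C) : Cmod q < 1 ->
  Ccv (cprod (jtp_factor q 1%C)) (2 * euler (q ^ 2) ^ 2 / euler q)%C.
Proof.
move=> q1; have [l hl] := jtp_cv 1%C q1.
suff <- : l = (2 * euler (q ^ 2) ^ 2 / euler q)%C by [].
have E0 := euler_neq0 q1; have hp := plus_pow_cv q1.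
apply: (Ccv_unique (Ccv_shift hl)).
have -> : (2 * euler (q ^ 2) ^ 2 / euler q =
  euler q * (euler (q ^ 2) / euler q) * (2 * (euler (q ^ 2) / euler q)))%C by field.
apply: Ccv_ext (Ccv_mult (Ccv_mult (Ccv_shift (euler_cv q1)) (Ccv_shift hp))
  (Ccv_mult (Ccv_const 2%C) hp)) => n.
have -> : (2 * cprod (fun k => 1 + q ^ k.+1) n =
  cprod (fun k => 1 + / 1 * q ^ k) n.+1)%C.
  rewrite cprod_recl; congr Cmult; first by rewrite /=; field.
  by apply: eq_cprod => k; field; exact: C1_nz.
rewrite -!cprod_mul; apply: eq_cprod => k; rewrite /jtp_factor; ring.
Qed.

(** The factors are (1 - q^(2k+2)) (1 + q^(2k+1))^2. The odd product is reached by multiplying by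
    the square of the even one, which completes it to the square of the full product of the 1 +
    q^k. *)
Lemma jtp_lim_phi (q : C) : Cmod q < 1 -> q <> 0%C ->
  Ccv (cprod (jtp_factor (q ^ 2) (/ q)))
    (euler (q ^ 2) ^ 5 / (euler q ^ 2 * euler (q ^ 4) ^ 2))%C.
Proof.
move=> q1 q0; have q21 := Cmod_Cpow_lt1 1 q1; have q41 := Cmod_Cpow_lt1 3 q1.
have [l hl] := jtp_cv (/ q)%C q21.
suff <- : l = (euler (q ^ 2) ^ 5 / (euler q ^ 2 * euler (q ^ 4) ^ 2))%C by [].
have E0 := euler_neq0 q1; have E20 := euler_neq0 q21; have E40 := euler_neq0 q41.
have hp := plus_pow_cv q1; have hp2 := plus_pow_cv q21.
rewrite -Cpow_mult_r (_ : (2 * 2)%coq_nat = 4%N) // in hp2.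
have hp' := Ccv_subseq (phi := fun n => (n + n)%N) _ hp.
have {}hp' := hp' (fun m => ex_intro _ m (fun n (h : (m <= n)%N) => leq_trans h (leq_addr n n))).
have h1 := Ccv_mult (euler_cv q21) (Ccv_mult hp' hp').
have h2 := Ccv_mult hl (Ccv_mult hp2 hp2).
have e : (l * (euler (q ^ 4) / euler (q ^ 2) * (euler (q ^ 4) / euler (q ^ 2))) =
  euler (q ^ 2) * (euler (q ^ 2) / euler q * (euler (q ^ 2) / euler q)))%C.
  apply: (Ccv_unique h2); apply: Ccv_ext h1 => n.
  have -> : cprod (fun k => 1 + q ^ k.+1)%C (n + n) =
     cprod (fun k => (1 + q ^ (k + k).+1) * (1 + q ^ (k + k).+2))%C n.
    by elim: n => // n IH; rewrite addSn addnS !cprodS IH; ring.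
  rewrite -!cprod_mul; apply: eq_cprod => k; rewrite /jtp_factor -!Cpow_mult_r.
  rewrite (_ : (2 * k)%coq_nat = (k + k)%N); last by lia.
  rewrite (_ : (2 * k.+1)%coq_nat = (k + k).+2); last by lia.
  by rewrite !Cpow_S; field.
have -> : l = (l * (euler (q ^ 4) / euler (q ^ 2) * (euler (q ^ 4) / euler (q ^ 2))) *
  (euler (q ^ 2) ^ 2 / euler (q ^ 4) ^ 2))%C by field.
by rewrite e; field.
Qed.

(** One triple factor is three consecutive factors of the Euler product, with exponents 3k + 3, 3k +
    2 and 3k + 1. *)
Lemma jtp_lim_pentagonal (q : C) : Cmod q < 1 -> q <> 0%C ->
  Ccv (cprod (jtp_factor (q ^ 3) (- / q))) (euler q).
Proof.
move=> q1 q0.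
have h : forall m, exists n0, forall n, (n0 <= n)%N -> (m <= 3 * n)%N.
  by move=> m; exists m => n; lia.
apply: Ccv_ext (Ccv_subseq h (euler_cv q1)).
elim=> // n IH; rewrite (_ : 3 * n.+1 = (3 * n).+3)%N; last by lia.
rewrite !qfacS IH cprodS /jtp_factor -!Cpow_mult_r.
rewrite (_ : (3 * n)%coq_nat = (3 * n)%N) //.
rewrite (_ : (3 * n.+1)%coq_nat = (3 * n).+3)%N; last by lia.
by rewrite !Cpow_S; field.
Qed.

(** Together the two products contain every 1 + q^j with j prime to 5 exactly once, so multiplying
    by the product of the 1 + q^(5j) completes them. Only l1 l2 is evaluated, hence the existential
    limits. *)
Lemma jtp_lim_quintic (q : C) : Cmod q < 1 -> q <> 0%C ->
  exists l1 l2, [/\ Ccv (cprod (jtp_factor (q ^ 5) (/ q))) l1,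
    Ccv (cprod (jtp_factor (q ^ 5) (/ q ^ 2))) l2 &
    (l1 * l2 = euler (q ^ 5) ^ 3 * euler (q ^ 2) / (euler q * euler (q ^ 10)))%C].
Proof.
move=> q1 q0; have q21 := Cmod_Cpow_lt1 1 q1.
have q51 := Cmod_Cpow_lt1 4 q1; have qx1 := Cmod_Cpow_lt1 9 q1.
have [l1 h1] := jtp_cv (/ q)%C q51; have [l2 h2] := jtp_cv (/ q ^ 2)%C q51.
exists l1, l2; split=> //.
have E0 := euler_neq0 q1; have E50 := euler_neq0 q51; have Ex0 := euler_neq0 qx1.
have hp := plus_pow_cv q1; have hp5 := plus_pow_cv q51.
rewrite -Cpow_mult_r (_ : (5 * 2)%coq_nat = 10%N) // in hp5.
have h : forall m, exists n0, forall n, (n0 <= n)%N -> (m <= 5 * n)%N.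
  by move=> m; exists m => n; lia.
have h3 := Ccv_mult (Ccv_mult h1 h2) hp5.
have h4 := Ccv_mult (Ccv_mult (euler_cv q51) (euler_cv q51)) (Ccv_subseq h hp).
have e : (l1 * l2 * (euler (q ^ 10) / euler (q ^ 5)) =
    euler (q ^ 5) * euler (q ^ 5) * (euler (q ^ 2) / euler q))%C.
  apply: (Ccv_unique h3); apply: Ccv_ext h4 => n.
  have -> : cprod (fun k => 1 + q ^ k.+1)%C (5 * n) =
     cprod (fun k => (1 + q ^ (5 * k).+1) * (1 + q ^ (5 * k).+2) *
       (1 + q ^ (5 * k).+3) * (1 + q ^ (5 * k).+4) * (1 + q ^ (5 * k).+4.+1))%C n.
    elim: n => // n IH; rewrite (_ : 5 * n.+1 = (5 * n).+4.+1)%N; last by lia.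
    by rewrite !cprodS IH; ring.
  rewrite -!cprod_mul; apply: eq_cprod => k; rewrite /jtp_factor -!Cpow_mult_r.
  rewrite (_ : (5 * k)%coq_nat = (5 * k)%N) //.
  rewrite (_ : (5 * k.+1)%coq_nat = (5 * k).+4.+1)%N; last by lia.
  by rewrite !Cpow_S [(q ^ 0)%C]/=; field.
have -> : (l1 * l2 = l1 * l2 * (euler (q ^ 10) / euler (q ^ 5)) *
  (euler (q ^ 5) / euler (q ^ 10)))%C by field.
by rewrite e; field.
Qed.

(** For z a primitive fifth root of unity the product of 1 + z^j x over j = 0, ..., 4 is 1 + x^5.
    The factors in z, z^2 and their inverses supply all j except 0, which the product of the 1 + q^k
    provides. *)
Lemma jtp_lim_zeta (q z : C) : Cmod q < 1 -> z <> 0%C ->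
  (1 + z + z ^ 2 + z ^ 3 + z ^ 4 = 0)%C ->
  exists l1 l2, [/\ Ccv (cprod (jtp_factor q z)) l1,
    Ccv (cprod (jtp_factor q (z ^ 2))) l2 &
    (l1 * l2 = - z * (euler q ^ 3 * euler (q ^ 10) /
      (euler (q ^ 2) * euler (q ^ 5))))%C].
Proof.
move=> q1 z0 zeta; have q21 := Cmod_Cpow_lt1 1 q1.
have q51 := Cmod_Cpow_lt1 4 q1; have qx1 := Cmod_Cpow_lt1 9 q1.
have [l1 h1] := jtp_cv z q1; have [l2 h2] := jtp_cv (z ^ 2)%C q1.
exists l1, l2; split=> //.
have E0 := euler_neq0 q1; have E20 := euler_neq0 q21.
have E50 := euler_neq0 q51; have Ex0 := euler_neq0 qx1.
have hp := plus_pow_cv q1; have hp5 := plus_pow_cv q51.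
rewrite -Cpow_mult_r (_ : (5 * 2)%coq_nat = 10%N) // in hp5.
have hE := euler_cv q1.
have z5 : (z ^ 5 = 1)%C.
  by rewrite (_ : (z ^ 5 = 1 + (z - 1) * (1 + z + z ^ 2 + z ^ 3 + z ^ 4))%C);
    [rewrite zeta; ring | ring].
have iz : (/ z = z ^ 4)%C.
  by rewrite -[LHS]Cmult_1_r -z5; field.
have iz2 : (/ z ^ 2 = z ^ 3)%C.
  by rewrite -[LHS]Cmult_1_r -z5; field.
(* The two inverse factors start at q^0; these initial factors are the origin of the - z in the
   statement. *)
have hc : ((1 + z ^ 4) * (1 + z ^ 3) = - z)%C.
  rewrite (_ : ((1 + z ^ 4) * (1 + z ^ 3) =
    (1 + z + z ^ 2 + z ^ 3 + z ^ 4) - z + (z ^ 5 - 1) * z ^ 2)%C); last by ring.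
  by rewrite zeta z5; ring.
have cyc (x : C) : ((1 + z * x) * (1 + z ^ 2 * x) * (1 + z ^ 4 * x) *
    (1 + z ^ 3 * x) * (1 + x) = 1 + x ^ 5)%C.
  have h14 : ((1 + z * x) * (1 + z ^ 4 * x) = 1 + (z + z ^ 4) * x + x ^ 2)%C.
    rewrite (_ : ((1 + z * x) * (1 + z ^ 4 * x) =
      1 + (z + z ^ 4) * x + z ^ 5 * x ^ 2)%C); last by ring.
    by rewrite z5; ring.
  have h23 : ((1 + z ^ 2 * x) * (1 + z ^ 3 * x) = 1 - (1 + z + z ^ 4) * x + x ^ 2)%C.
    rewrite (_ : ((1 + z ^ 2 * x) * (1 + z ^ 3 * x) =
      1 + ((1 + z + z ^ 2 + z ^ 3 + z ^ 4) - (1 + z + z ^ 4)) * x + z ^ 5 * x ^ 2)%C);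
      last by ring.
    by rewrite zeta z5; ring.
  rewrite (_ : ((1 + z * x) * (1 + z ^ 2 * x) * (1 + z ^ 4 * x) *
    (1 + z ^ 3 * x) * (1 + x) = ((1 + z * x) * (1 + z ^ 4 * x)) *
    ((1 + z ^ 2 * x) * (1 + z ^ 3 * x)) * (1 + x))%C); last by ring.
  have hab : ((z + z ^ 4) * (1 + z + z ^ 4) = 1)%C.
    rewrite (_ : ((z + z ^ 4) * (1 + z + z ^ 4) =
      (1 + z + z ^ 2 + z ^ 3 + z ^ 4) + (z ^ 5 - 1) * (2 + z ^ 3) + 1)%C); last by ring.
    by rewrite zeta z5; ring.
  rewrite h14 h23 (_ : ((1 + (z + z ^ 4) * x + x ^ 2) *
    (1 - (1 + z + z ^ 4) * x + x ^ 2) * (1 + x) =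
    (1 + x) * (1 - x + 2 * x ^ 2 - x ^ 3 + x ^ 4 -
    ((z + z ^ 4) * (1 + z + z ^ 4)) * x ^ 2))%C); last by ring.
  by rewrite hab; ring.
have hW (w : C) : exists l, Ccv (cprod (fun k => 1 + w * q ^ k.+1)%C) l.
  have [l hl] := cprod_pow_cv (w * q)%C q1; exists l.
  by apply: Ccv_ext hl => n; apply: eq_cprod => k; rewrite Cpow_S; ring.
have [w1 hw1] := hW z; have [w2 hw2] := hW (z ^ 2)%C.
have [w3 hw3] := hW (z ^ 3)%C; have [w4 hw4] := hW (z ^ 4)%C.
have ew : (w1 * w2 * w4 * w3 * (euler (q ^ 2) / euler q) = euler (q ^ 10) / euler (q ^ 5))%C.
  apply: (Ccv_unique _ hp5).
  apply: Ccv_ext (Ccv_mult (Ccv_mult (Ccv_mult (Ccv_mult hw1 hw2) hw4) hw3) hp) => n.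
  rewrite -!cprod_mul; apply: eq_cprod => k.
  by rewrite cyc -!Cpow_mult_r multE mulnC.
have recl (w : C) n : cprod (fun k => 1 + w * q ^ k)%C n.+1 =
    ((1 + w) * cprod (fun k => 1 + w * q ^ k.+1) n)%C.
  by rewrite cprod_recl Cmult_1_r.
have el : (l1 * l2 = (euler q * w1) * ((1 + z ^ 4) * w4) *
    ((euler q * w2) * ((1 + z ^ 3) * w3)))%C.
  apply: (Ccv_unique (Ccv_mult (Ccv_shift h1) (Ccv_shift h2))).
  apply: Ccv_ext (Ccv_mult
    (Ccv_mult (Ccv_mult (Ccv_shift hE) (Ccv_shift hw1)) (Ccv_mult (Ccv_const _) hw4))
    (Ccv_mult (Ccv_mult (Ccv_shift hE) (Ccv_shift hw2)) (Ccv_mult (Ccv_const _) hw3))) => n.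
  rewrite -!recl -!cprod_mul; apply: eq_cprod => k.
  by rewrite /jtp_factor iz iz2.
rewrite (_ : (l1 * l2 = ((1 + z ^ 4) * (1 + z ^ 3)) * euler q ^ 2 *
    (w1 * w2 * w4 * w3 * (euler (q ^ 2) / euler q)) * (euler q / euler (q ^ 2)))%C).
  by rewrite hc ew; field.
by rewrite el; field.
Qed.

(** * Theta series *)

Ltac Zify.zify_post_hook ::= Z.to_euclidean_division_equations.

Definition abs_sum (I : eqType) (f : I -> C) (a : C) : Prop :=
  abs_bounded f /\ has_sum f a.

Lemma abs_sum_ext (I : eqType) (f g : I -> C) (a : C) :
  (forall i, f i = g i) -> abs_sum f a -> abs_sum g a.
Proof.
move=> fg [[B hB] fa]; split; last exact: has_sum_ext fa.
exists B => s us; rewrite [X in X <= _](_ : _ = rsum s (fun i => Cmod (f i))).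
  exact: hB.
by apply: eq_bigr => i _; rewrite fg.
Qed.

Lemma has_sum_abs_prod (I J : eqType) (f : I -> C) (g : J -> C) (a b : C) :
  abs_sum f a -> abs_sum g b ->
  has_sum (fun p : I * J => f p.1 * g p.2)%C (a * b)%C.
Proof. by move=> [bf fa] [bg gb]; apply: has_sum_prod. Qed.

(** The tool for matching a residue class with a known series: [h] parametrises the class, and [k]
    inverts it by floor division, so that [h (k i)] returns to i exactly on the class. *)
Lemma has_sum_class (I J : eqType) (h : J -> I) (k : I -> J) (P : pred I)
    (f : J -> C) (F : I -> C) (a : C) :
  (forall j, k (h j) = j) -> (forall i, P i = (h (k i) == i)) ->
  (forall j, f j = F (h j)) -> has_sum f a ->
  has_sum (fun i => if P i then F i else RtoC 0) a.
Proof.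
move=> hK PE fF /(has_sum_image hK); apply: has_sum_ext => i.
by rewrite PE; case: eqP => // e; rewrite fF e.
Qed.

Lemma has_sum_bij (I J : eqType) (h : J -> I) (k : I -> J) (f : I -> C) (a : C) :
  cancel h k -> cancel k h -> has_sum f a -> has_sum (fun j => f (h j)) a.
Proof.
by move=> hK kH /(has_sum_image kH); apply: has_sum_ext => j; rewrite hK eqxx.
Qed.

Lemma cexp_IZR_nat (r : R) (k : nat) (x : C) :
  r = INR k -> cexp (r * x)%C = (cexp x ^ k)%C.
Proof. by move=> ->; apply: cexp_nat. Qed.

Lemma cexp_PI : cexp (PI * Ci)%C = (- (1))%C.
Proof.
by apply: Ceq_ReIm; rewrite /cexp /= ?Rmult_0_l ?Rmult_0_r Rminus_0_r exp_0
  ?Rmult_1_r ?Rplus_0_l ?Rplus_0_r ?cos_PI ?sin_PI; ring.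
Qed.

Lemma cexp_2PI (n : Z) : cexp (IZR (2 * n) * (PI * Ci))%C = 1%C.
Proof.
have h2 : cexp (2 * (PI * Ci))%C = 1%C.
  by rewrite (@cexp_IZR_nat _ 2) ?cexp_PI /=; [ring | lra].
have hn k : cexp (INR k * (2 * (PI * Ci)))%C = 1%C.
  by rewrite cexp_nat h2 Cpow_1_l.
rewrite mult_IZR RtoC_mult.
have -> : (2 * IZR n * (PI * Ci) = IZR n * (2 * (PI * Ci)))%C by ring.
case: (Z_lt_dec n 0) => h.
  have -> : n = (- Z.of_nat (Z.to_nat (- n)))%Z by lia.
  rewrite opp_IZR -INR_IZR_INZ RtoC_opp.
  have -> : forall x y : C, (- x * y = - (x * y))%C by move=> x y; ring.
  by rewrite cexp_opp hn; field.
have -> : n = Z.of_nat (Z.to_nat n) by lia.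
by rewrite -INR_IZR_INZ hn.
Qed.

(** Signs (-1)^n are carried as exp (n pi i), so reindexings that agree only up to parity are
    corrected by a multiple of 2 pi i. *)
Lemma cexp_period (x : C) (n : Z) : cexp (x + IZR (2 * n) * (PI * Ci))%C = cexp x.
Proof. by rewrite cexp_add cexp_2PI Cmult_1_r. Qed.

Lemma jtp_abs_sum (s w q z l : C) : Re s < 0 -> cexp s = q -> cexp w = z ->
  Ccv (cprod (jtp_factor q z)) l -> abs_sum (jtp_term s w : Z -> C) l.
Proof. by move=> s0 <- <-; apply: jacobi_triple_product. Qed.

Lemma Cmod_cexp_lt1 (s : C) : Re s < 0 -> Cmod (cexp s) < 1.
Proof. by move=> s0; rewrite Cmod_cexp -exp_0; apply: exp_increasing. Qed.

Lemma Re_scal (r : R) (s : C) : Re (r * s)%C = r * Re s.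
Proof. by rewrite /Re /=; ring. Qed.

Ltac exponent := congr cexp;
  rewrite ?(mult_IZR, plus_IZR, minus_IZR, opp_IZR)
    ?(RtoC_mult, RtoC_plus, RtoC_minus, RtoC_opp); field.

(** The sum is 2 psi(q): over all of Z each triangular exponent occurs twice, at n and -1 - n. *)
Lemma psi_sum (s : C) : Re s < 0 ->
  abs_sum (fun n : Z => cexp (IZR (n * (n + 1)) / 2 * s)%C)
    (2 * euler (cexp s ^ 2) ^ 2 / euler (cexp s))%C.
Proof.
move=> s0; have := jtp_lim1 (Cmod_cexp_lt1 s0).
move/(jtp_abs_sum s0 erefl cexp0); apply: abs_sum_ext => n.
by rewrite /jtp_term; exponent.
Qed.

Lemma phi_sum (s : C) : Re s < 0 ->
  abs_sum (fun n : Z => cexp (IZR (n * n) * s)%C)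
    (euler (cexp s ^ 2) ^ 5 / (euler (cexp s) ^ 2 * euler (cexp s ^ 4) ^ 2))%C.
Proof.
move=> s0; have := jtp_lim_phi (Cmod_cexp_lt1 s0) (@cexp_neq0 s).
have h2 : Re (2 * s)%C < 0 by rewrite Re_scal; lra.
have e2 : cexp (2 * s)%C = (cexp s ^ 2)%C by apply: cexp_IZR_nat => /=; lra.
move/(jtp_abs_sum h2 e2 (cexp_opp s)); apply: abs_sum_ext => n.
by rewrite /jtp_term; exponent.
Qed.

Lemma pentagonal_sum (s : C) : Re s < 0 ->
  abs_sum (fun n : Z => cexp (IZR (n * (3 * n + 1)) / 2 * s + IZR n * (PI * Ci))%C)
    (euler (cexp s)).
Proof.
move=> s0; have := jtp_lim_pentagonal (Cmod_cexp_lt1 s0) (@cexp_neq0 s).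
have h3 : Re (3 * s)%C < 0 by rewrite Re_scal; lra.
have e3 : cexp (3 * s)%C = (cexp s ^ 3)%C by apply: cexp_IZR_nat => /=; lra.
have e : cexp (- s + PI * Ci)%C = (- / cexp s)%C.
  by rewrite cexp_add cexp_PI cexp_opp; ring.
move/(jtp_abs_sum h3 e3 e); apply: abs_sum_ext => n.
by rewrite /jtp_term; exponent.
Qed.

Lemma quintic_sum (s : C) : Re s < 0 ->
  has_sum (fun p : Z * Z =>
      cexp (IZR (p.1 * (5 * p.1 + 3) + p.2 * (5 * p.2 + 1)) / 2 * s)%C)
    (euler (cexp s ^ 5) ^ 3 * euler (cexp s ^ 2) /
      (euler (cexp s) * euler (cexp s ^ 10)))%C.
Proof.
move=> s0.
have [l1 [l2 [h1 h2 <-]]] := jtp_lim_quintic (Cmod_cexp_lt1 s0) (@cexp_neq0 s).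
have h5 : Re (5 * s)%C < 0 by rewrite Re_scal; lra.
have e5 : cexp (5 * s)%C = (cexp s ^ 5)%C by apply: cexp_IZR_nat => /=; lra.
have e2 : cexp (- (2 * s))%C = (/ cexp s ^ 2)%C.
  by rewrite cexp_opp (@cexp_IZR_nat _ 2) //=; lra.
have := has_sum_abs_prod (jtp_abs_sum h5 e5 (cexp_opp s) h1) (jtp_abs_sum h5 e5 e2 h2).
apply: has_sum_ext => -[m n]; cbn [fst snd]; rewrite /jtp_term -cexp_add; exponent.
Qed.

Ltac residue_class := move=> [m n]; cbn [fst snd]; rewrite xpair_eqE;
  apply/idP/andP => [/Z.eqb_eq h | [/eqP h /eqP h']];
  [split; apply/eqP; lia | apply/Z.eqb_eq; lia].

(** * Lattice identities of level 5 *)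

Definition psi_lattice (s : C) (p : Z * Z) : C :=
  cexp (IZR (p.1 * (p.1 + 1) + p.2 * (p.2 + 1)) / 2 * s)%C.

Lemma psi_lattice_sum (s : C) : Re s < 0 ->
  has_sum (psi_lattice s : Z * Z -> C)
    ((2 * euler (cexp s ^ 2) ^ 2 / euler (cexp s)) ^ 2)%C.
Proof.
move=> s0; have h := psi_sum s0; have := has_sum_abs_prod h h.
rewrite (_ : forall x : C, (x * x = x ^ 2)%C); last by move=> x; ring.
apply: has_sum_ext => -[m n]; rewrite /psi_lattice; cbn [fst snd].
by rewrite -cexp_add; exponent.
Qed.

(* With x = 2m + 1 and y = 2n + 1 the exponent of [psi_lattice] is
   (x^2 + y^2 - 2) / 8, and the class m + 2n = 1 mod 5 is the set of Gaussian
   integers x + iy divisible by 1 + 2i. *)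
Lemma psi_lattice_class1 (s : C) : Re s < 0 ->
  has_sum (fun p : Z * Z =>
      if ((p.1 + 2 * p.2) mod 5 =? 1)%Z then psi_lattice s p else RtoC 0)
    (cexp s * (2 * euler (cexp s ^ 10) ^ 2 / euler (cexp s ^ 5)) ^ 2)%C.
Proof.
move=> s0.
have h5 : Re (5 * s)%C < 0 by rewrite Re_scal; lra.
have e5 : cexp (5 * s)%C = (cexp s ^ 5)%C by apply: cexp_IZR_nat => /=; lra.
have := has_sum_scal (cexp s) (psi_lattice_sum h5).
rewrite e5 -Cpow_mult_r (_ : (5 * 2)%coq_nat = 10%N) //.
(* In the coordinates x, y the map [h] is multiplication by 1 + 2i. The norm N becomes 5 N, and (5 N
   - 2) / 8 = 5 (N - 2) / 8 + 1 accounts for q^5 and for the factor [cexp s]. *)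
apply: (has_sum_class (h := fun p : Z * Z => (p.1 - 2 * p.2 - 1, 2 * p.1 + p.2 + 1)%Z)
  (k := fun p : Z * Z => ((p.1 + 2 * p.2 - 1) / 5, (p.2 - 2 * p.1 - 3) / 5)%Z)).
- by move=> [m n]; cbn [fst snd]; congr pair; lia.
- residue_class.
- move=> [m n]; rewrite /psi_lattice; cbn [fst snd]; rewrite -cexp_add; exponent.
Qed.

(* On each of the four classes m + 2n <> 1 mod 5, (2 + i) (x + iy) = a + ib with
   {a, b} = {+-3, +-1} mod 10 and fixed signs; a^2 + b^2 = 5 (x^2 + y^2) gives the
   exponents of [quintic_sum]. *)
Lemma psi_quintic (s : C) : Re s < 0 ->
  let E k := euler (cexp s ^ k)%C in
  (E 2%N ^ 4 / E 1%N ^ 2 - cexp s * E 10%N ^ 4 / E 5%N ^ 2 =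
   E 5%N ^ 3 * E 2%N / (E 1%N * E 10%N))%C.
Proof.
move=> s0 E.
have E0 k : E k.+1 <> 0%C by apply: euler_neq0; apply: Cmod_Cpow_lt1; apply: Cmod_cexp_lt1.
have e1 : euler (cexp s) = E 1%N by rewrite /E Cpow_1_r.
have := quintic_sum s0; rewrite e1 -!/(E _).
set K := (_ / _)%C => hK.
pose cls r p := if ((p.1 + 2 * p.2) mod 5 =? r)%Z then psi_lattice s p else RtoC 0.
have h0 : has_sum (cls 0%Z) K.
  apply: (has_sum_class (h := fun p : Z * Z => (2 * p.2 + p.1, 2 * p.1 - p.2)%Z)
    (k := fun p : Z * Z => ((p.1 + 2 * p.2) / 5, - (p.2 - 2 * p.1) / 5)%Z) _ _ _ hK).
  - by move=> [m n]; cbn [fst snd]; congr pair; lia.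
  - residue_class.
  - by move=> [m n]; rewrite /psi_lattice; cbn [fst snd]; exponent.
have h1 := psi_lattice_class1 s0.
have h2 : has_sum (cls 2%Z) K.
  apply: (has_sum_class (h := fun p : Z * Z => (- 2 * p.2 - p.1 - 1, - 2 * p.1 + p.2 - 1)%Z)
    (k := fun p : Z * Z => (- (p.1 + 2 * p.2 + 3) / 5, (p.2 - 2 * p.1 - 1) / 5)%Z) _ _ _ hK).
  - by move=> [m n]; cbn [fst snd]; congr pair; lia.
  - residue_class.
  - by move=> [m n]; rewrite /psi_lattice; cbn [fst snd]; exponent.
have h3 : has_sum (cls 3%Z) K.
  apply: (has_sum_class (h := fun p : Z * Z => (2 * p.1 - p.2, - 2 * p.2 - p.1 - 1)%Z)
    (k := fun p : Z * Z => (- (p.2 - 2 * p.1 + 1) / 5, - (p.1 + 2 * p.2 + 2) / 5)%Z) _ _ _ hK).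
  - by move=> [m n]; cbn [fst snd]; congr pair; lia.
  - residue_class.
  - by move=> [m n]; rewrite /psi_lattice; cbn [fst snd]; exponent.
have h4 : has_sum (cls 4%Z) K.
  apply: (has_sum_class (h := fun p : Z * Z => (- 2 * p.1 + p.2 - 1, 2 * p.2 + p.1)%Z)
    (k := fun p : Z * Z => ((p.2 - 2 * p.1 - 2) / 5, (p.1 + 2 * p.2 + 1) / 5)%Z) _ _ _ hK).
  - by move=> [m n]; cbn [fst snd]; congr pair; lia.
  - residue_class.
  - by move=> [m n]; rewrite /psi_lattice; cbn [fst snd]; exponent.
(* Four classes contribute K each; this 4 cancels the one in (2 psi)^2. *)
have h := has_sum_add (has_sum_add (has_sum_add (has_sum_add h0 h1) h2) h3) h4.
have := psi_lattice_sum s0; rewrite e1 -!/(E _) => hG.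
have e := has_sum_unique hG (has_sum_ext _ h).
have {}e : ((2 * E 2%N ^ 2 / E 1%N) ^ 2 =
    K + cexp s * (2 * E 10%N ^ 2 / E 5%N) ^ 2 + K + K + K)%C.
  apply: e => p; rewrite /cls; move: (psi_lattice s p) => x.
  have : (0 <= (p.1 + 2 * p.2) mod 5 < 5)%Z by lia.
  move: (_ mod 5)%Z => r hr.
  have : r = 0%Z \/ r = 1%Z \/ r = 2%Z \/ r = 3%Z \/ r = 4%Z by lia.
  by move=> [->|[->|[->|[->|->]]]] /=; ring.
have E1 := E0 0%N; have E5 := E0 4%N.
have -> : (E 2%N ^ 4 / E 1%N ^ 2 - cexp s * E 10%N ^ 4 / E 5%N ^ 2 =
  ((2 * E 2%N ^ 2 / E 1%N) ^ 2 - cexp s * (2 * E 10%N ^ 2 / E 5%N) ^ 2) / 4)%C by field.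
by rewrite e; field.
Qed.

(** The additive character exp (2 pi i n / 5), kept as an exponential so that it merges with the
    exponents of the series. *)
Definition chi5 (n : Z) : C := cexp (IZR n * (RtoC (2 / 5) * (PI * Ci)))%C.

Lemma chi5_shift (a k : Z) : chi5 (a + 5 * k) = chi5 a.
Proof.
rewrite /chi5 -(cexp_period (IZR a * _)%C k); congr cexp.
rewrite RtoC_div; last by lra.
by rewrite plus_IZR !mult_IZR RtoC_plus !RtoC_mult; field.
Qed.

Lemma chi5_nat (k : nat) : chi5 (Z.of_nat k) = (chi5 1 ^ k)%C.
Proof.
by rewrite /chi5 -INR_IZR_INZ cexp_nat Cmult_1_l.
Qed.

Lemma chi5_cyclotomic :
  (1 + chi5 1 + chi5 1 ^ 2 + chi5 1 ^ 3 + chi5 1 ^ 4 = 0)%C.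
Proof.
have z5 : (chi5 1 ^ 5 = 1)%C.
  rewrite -chi5_nat (_ : Z.of_nat 5 = 0 + 5 * 1)%Z // chi5_shift.
  by rewrite /chi5 -[RHS]cexp0; congr cexp; ring.
(* The imaginary part is sin (2 pi / 5), which is positive. *)
have n1 : (chi5 1 - 1)%C <> 0%C.
  have e : (1 * (RtoC (2 / 5) * (PI * Ci)))%C = (0, 2 / 5 * PI).
    by apply: Ceq_ReIm; rewrite /Re /Im /=; ring.
  move=> /(f_equal Im); rewrite /chi5 e /cexp /Im /= exp_0.
  have : 0 < sin (2 / 5 * PI) by apply: sin_gt_0; have := PI_RGT_0; lra.
  lra.
set z := chi5 1 in z5 n1 *.
have e : ((z - 1) * (1 + z + z ^ 2 + z ^ 3 + z ^ 4) = 0)%C.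
  rewrite (_ : ((z - 1) * (1 + z + z ^ 2 + z ^ 3 + z ^ 4) = z ^ 5 - 1)%C); last by ring.
  by rewrite z5; ring.
have -> : (1 + z + z ^ 2 + z ^ 3 + z ^ 4 =
  / (z - 1) * ((z - 1) * (1 + z + z ^ 2 + z ^ 3 + z ^ 4)))%C by field.
by rewrite e; ring.
Qed.

(** Since 2 generates the units mod 5, the arguments run through all nonzero multiples of u. The
    total is 5 times the indicator of 5 | u, minus 1; the nested doublings are those produced by
    repeated quarter turns. *)
Lemma chi5_orbit_sum (u : Z) :
  (chi5 u + chi5 (2 * u) + chi5 (2 * (2 * u)) + chi5 (2 * (2 * (2 * u))) =
   if (u mod 5 =? 0)%Z then RtoC 4 else RtoC (-1))%C.
Proof.
have cyc := chi5_cyclotomic.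
have c0 : chi5 0 = 1%C by rewrite (chi5_nat 0).
have c2 := chi5_nat 2; have c3 := chi5_nat 3; have c4 := chi5_nat 4.
rewrite /= -/(chi5 _) in c2 c3 c4.
have red r k a : a = (r + 5 * k)%Z -> chi5 a = chi5 r by move=> ->; exact: chi5_shift.
have [k [r [hu hr]]] : exists k r : Z, u = (r + 5 * k)%Z /\
    (r = 0 \/ r = 1 \/ r = 2 \/ r = 3 \/ r = 4)%Z.
  by exists (u / 5)%Z, (u mod 5)%Z; lia.
move: hr; rewrite (red r k u) //.
rewrite (red (2 * r)%Z (2 * k)%Z (2 * u)%Z); last by lia.
rewrite (red (4 * r)%Z (4 * k)%Z (2 * (2 * u))%Z); last by lia.
rewrite (red (8 * r)%Z (8 * k)%Z (2 * (2 * (2 * u)))%Z); last by lia.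
have -> : (u mod 5 = r mod 5)%Z by lia.
have c6 : chi5 6 = chi5 1 by apply: (red 1%Z 1%Z); lia.
have c8 : chi5 8 = chi5 3 by apply: (red 3%Z 1%Z); lia.
have c12 : chi5 12 = chi5 2 by apply: (red 2%Z 2%Z); lia.
have c16 : chi5 16 = chi5 1 by apply: (red 1%Z 3%Z); lia.
have c24 : chi5 24 = chi5 4 by apply: (red 4%Z 4%Z); lia.
have c32 : chi5 32 = chi5 2 by apply: (red 2%Z 6%Z); lia.
have s0 : (chi5 1 + chi5 2 + chi5 3 + chi5 4 = RtoC (-1))%C.
  rewrite c2 c3 c4.
  have -> : (RtoC (-1) = - (1) + (1 + chi5 1 + chi5 1 ^ 2 + chi5 1 ^ 3 + chi5 1 ^ 4))%C.
    by rewrite cyc; ring.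
  ring.
move=> [->|[->|[->|[->|->]]]] /=; rewrite ?(c0, c6, c8, c12, c16, c24, c32).
- by ring.
- by rewrite -s0; ring.
- by rewrite -s0; ring.
- by rewrite -s0; ring.
- by rewrite -s0; ring.
Qed.

(* The summand is [psi_lattice] twisted by a fifth root of unity; the rotation by
   a quarter turn squares the twist, so that the four nontrivial twists have the
   same sum and together detect the class m + 2n = 1 mod 5. *)
Lemma psi_quintic_conjugate (s : C) : Re s < 0 ->
  let E k := euler (cexp s ^ k)%C in
  (E 2%N ^ 4 / E 1%N ^ 2 - 5 * cexp s * E 10%N ^ 4 / E 5%N ^ 2 =
   E 1%N ^ 3 * E 10%N / (E 2%N * E 5%N))%C.
Proof.
move=> s0 E.
have E0 k : E k.+1 <> 0%C by apply: euler_neq0; apply: Cmod_Cpow_lt1; apply: Cmod_cexp_lt1.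
have e1 : euler (cexp s) = E 1%N by rewrite /E Cpow_1_r.
pose w := (RtoC (2 / 5) * (PI * Ci))%C.
have ez : cexp w = chi5 1 by rewrite /chi5 Cmult_1_l.
have ez2 : cexp (2 * w)%C = (chi5 1 ^ 2)%C.
  by rewrite -ez; apply: cexp_IZR_nat => /=; lra.
have z0 : chi5 1 <> 0%C by apply: cexp_neq0.
have [l1 [l2 [h1 h2 hl]]] := jtp_lim_zeta (Cmod_cexp_lt1 s0) z0 chi5_cyclotomic.
(* Dividing by the root of unity cancels the factor - z up to sign and shifts the twist to m + 2n -
   1, which vanishes mod 5 exactly on the distinguished class. *)
have := has_sum_scal (/ chi5 1)%C (has_sum_abs_prod
  (jtp_abs_sum s0 erefl ez h1) (jtp_abs_sum s0 erefl ez2 h2)).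
rewrite hl e1 -!/(E _).
have -> : (/ chi5 1 * (- chi5 1 * (E 1%N ^ 3 * E 10%N / (E 2%N * E 5%N))) =
  - (E 1%N ^ 3 * E 10%N / (E 2%N * E 5%N)))%C.
  by field; split; [exact: E0 | split; [exact: E0 | exact: z0]].
set R := (_ / _)%C => hS.
pose u (p : Z * Z) := (p.1 + 2 * p.2 - 1)%Z.
pose F c p := (psi_lattice s p * chi5 (c (u p)))%C.
have hF : has_sum (F id) (- R)%C.
  move: hS; apply: has_sum_ext => -[m n]; rewrite /F /psi_lattice /jtp_term /u /chi5.
  by cbn [fst snd]; rewrite -cexp_opp -!cexp_add -/w; exponent.
(* The map (m, n) -> (-n - 1, m) is multiplication by i on x + iy. It preserves the norm and sends u
   to 2u - 5n. *)
have rot c k : (forall x y, c (2 * x - 5 * y)%Z = c (2 * x) + 5 * (k * y))%Z ->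
    has_sum (F c) (- R)%C -> has_sum (F (fun x => c (2 * x)%Z)) (- R)%C.
  move=> hc; move/(has_sum_bij (h := fun p : Z * Z => (- p.2 - 1, p.1)%Z)
    (k := fun p : Z * Z => (p.2, - p.1 - 1)%Z)) => hb.
  apply: has_sum_ext (hb _ _) => -[m n]; last 2 first.
  - by cbn [fst snd]; congr pair; lia.
  - by cbn [fst snd]; congr pair; lia.
  rewrite /F /u; cbn [fst snd]; congr Cmult.
    by rewrite /psi_lattice; cbn [fst snd]; exponent.
  by rewrite -[RHS](chi5_shift _ (k * n)) -hc; congr (chi5 (c _)); lia.
have hF2 : has_sum (F (fun x => 2 * x)%Z) (- R)%C.
  by apply: (rot id (- 1)%Z) hF => x y; lia.
have hF4 : has_sum (F (fun x => 2 * (2 * x))%Z) (- R)%C.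
  by apply: (rot (fun x => 2 * x)%Z (- 2)%Z) hF2 => x y; lia.
have hF8 : has_sum (F (fun x => 2 * (2 * (2 * x)))%Z) (- R)%C.
  by apply: (rot (fun x => 2 * (2 * x))%Z (- 4)%Z) hF4 => x y; lia.
have hsum := has_sum_add (has_sum_add (has_sum_add hF hF2) hF4) hF8.
have h5 := has_sum_scal 5%C (psi_lattice_class1 s0).
have hG := has_sum_scal (- (1))%C (psi_lattice_sum s0).
have := has_sum_unique hsum (has_sum_ext _ (has_sum_add h5 hG)).
rewrite e1 -!/(E _) => e.
have {}e : (- R + - R + - R + - R =
    5 * (cexp s * (2 * E 10%N ^ 2 / E 5%N) ^ 2) + - (1) * (2 * E 2%N ^ 2 / E 1%N) ^ 2)%C.
  apply: e => p; rewrite /F -!CmultDr chi5_orbit_sum.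
  rewrite (_ : (u p mod 5 =? 0)%Z = ((p.1 + 2 * p.2) mod 5 =? 1)%Z); last first.
    case: p => m n; rewrite /u; cbn [fst snd].
    by apply/idP/idP => /Z.eqb_eq h; apply/Z.eqb_eq; lia.
  by case: ifP => _; ring.
have E1 := E0 0%N; have E5 := E0 4%N.
have -> : (E 2%N ^ 4 / E 1%N ^ 2 - 5 * cexp s * E 10%N ^ 4 / E 5%N ^ 2 =
  - (5 * (cexp s * (2 * E 10%N ^ 2 / E 5%N) ^ 2) +
     - (1) * (2 * E 2%N ^ 2 / E 1%N) ^ 2) / 4)%C by field.
by rewrite -e; field.
Qed.

(* With x = 2k + 1 - v and y = v, the summand at (k, v) is
   (-1)^y q^((x^2 + 5 y^2 - 1) / 4), where x + y is odd. *)
Definition mixed_lattice (s : C) (p : Z * Z) : C :=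
  cexp (IZR (2 * p.1 * (p.1 + 1) + 3 * p.2 * p.2 - (2 * p.1 + 1) * p.2) / 2 * s +
        IZR p.2 * (PI * Ci))%C.

(* The classes k = 0, 2 mod 3 come from (1 + sqrt(-5)) (x + y sqrt(-5)), whose
   norm form gives the exponents of the pentagonal series of E_1 and E_5. *)
Lemma psi_phi_quintic (s : C) : Re s < 0 ->
  let E k := euler (cexp s ^ k)%C in
  let psi k := (E (2 * k)%N ^ 2 / E k)%C in
  let phi k := (E (2 * k)%N ^ 5 / (E k ^ 2 * E (4 * k)%N ^ 2))%C in
  (psi 2%N * phi 5%N - cexp s * psi 10%N * phi 1%N = E 1%N * E 5%N)%C.
Proof.
move=> s0 E psi phi.
have e1 : euler (cexp s) = E 1%N by rewrite /E Cpow_1_r.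
have Eexp k r : r = INR k.+1 -> Re (r * s)%C < 0 /\ cexp (r * s)%C = (cexp s ^ k.+1)%C.
  move=> hr; split; last exact: cexp_IZR_nat.
  by rewrite Re_scal hr S_INR; have := pos_INR k; nra.
have [r2 q2] := Eexp 1%N 2 ltac:(rewrite /=; lra).
have [r5 q5] := Eexp 4%N 5 ltac:(rewrite /=; lra).
have [r10 q10] := Eexp 9%N 10 ltac:(rewrite /=; lra).
have hpsi2 := psi_sum r2; have hphi5 := phi_sum r5.
have hpsi10 := psi_sum r10; have hphi1 := phi_sum s0.
have hp1 := pentagonal_sum s0; have hp5 := pentagonal_sum r5.
rewrite q2 -!Cpow_mult_r in hpsi2; rewrite q5 -!Cpow_mult_r in hphi5.
rewrite q10 -!Cpow_mult_r in hpsi10; rewrite q5 in hp5.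
rewrite e1 in hp1; rewrite e1 in hphi1.
have psi2 : psi 2%N = (E 4%N ^ 2 / E 2%N)%C by [].
have psi10 : psi 10%N = (E 20%N ^ 2 / E 10%N)%C by [].
have phi1 : phi 1%N = (E 2%N ^ 5 / (E 1%N ^ 2 * E 4%N ^ 2))%C by [].
have phi5 : phi 5%N = (E 10%N ^ 5 / (E 5%N ^ 2 * E 20%N ^ 2))%C by [].
(* For v even, x is odd and y even, and x^2 + 5 y^2 separates into psi(q^2) phi(q^5). *)
have hev : has_sum (fun p : Z * Z => if Z.even p.2 then mixed_lattice s p else RtoC 0)
    (2 * psi 2%N * phi 5%N)%C.
  rewrite (_ : (2 * psi 2%N * phi 5%N = (2 * E 4%N ^ 2 / E 2%N) *
    (E 10%N ^ 5 / (E 5%N ^ 2 * E 20%N ^ 2)))%C); last first.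
    by rewrite psi2 phi5 /Cdiv; ring.
  apply: (has_sum_class (h := fun p : Z * Z => (p.1 + p.2, 2 * p.2)%Z)
    (k := fun p : Z * Z => (p.1 - p.2 / 2, p.2 / 2)%Z) _ _ _
    (has_sum_abs_prod hpsi2 hphi5)).
  - by move=> [m n]; cbn [fst snd]; congr pair; lia.
  - move=> [m n]; cbn [fst snd]; rewrite xpair_eqE.
    apply/idP/andP => [/Z.even_spec [x h] | [/eqP h /eqP h']].
      by split; apply/eqP; lia.
    by apply/Z.even_spec; exists (n / 2)%Z.
  - move=> [m n]; rewrite /mixed_lattice; cbn [fst snd]; rewrite -cexp_add.
    by rewrite -[LHS](cexp_period _ n); exponent.
(* For v odd, x is even and y odd; the sign is -1 and the constant part of the exponent is 1. *)
have hod : has_sum (fun p : Z * Z => if Z.odd p.2 then mixed_lattice s p else RtoC 0)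
    (- (2 * cexp s * psi 10%N * phi 1%N))%C.
  rewrite (_ : (- (2 * cexp s * psi 10%N * phi 1%N) = cexp (s + PI * Ci) *
    ((2 * E 20%N ^ 2 / E 10%N) * (E 2%N ^ 5 / (E 1%N ^ 2 * E 4%N ^ 2))))%C); last first.
    by rewrite cexp_add cexp_PI psi10 phi1 /Cdiv; ring.
  apply: (has_sum_class (h := fun p : Z * Z => (p.1 + p.2, 2 * p.1 + 1)%Z)
    (k := fun p : Z * Z => (p.2 / 2, p.1 - p.2 / 2)%Z) _ _ _
    (has_sum_scal _ (has_sum_abs_prod hpsi10 hphi1))).
  - by move=> [m n]; cbn [fst snd]; congr pair; lia.
  - move=> [m n]; cbn [fst snd]; rewrite xpair_eqE.
    apply/idP/andP => [/Z.odd_spec [x h] | [/eqP h /eqP h']].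
      by split; apply/eqP; lia.
    by apply/Z.odd_spec; exists (n / 2)%Z; lia.
  - move=> [m n]; rewrite /mixed_lattice; cbn [fst snd]; rewrite -!cexp_add.
    by rewrite -[LHS](cexp_period _ m); exponent.
have hK := has_sum_abs_prod hp1 hp5; rewrite -!/(E _) in hK.
pose cls r p := if (p.1 mod 3 =? r)%Z then mixed_lattice s p else RtoC 0.
(* With X = 6m + 1 and Y = 6n + 1 the map gives 6 (x + y sqrt(-5)) = (1 - sqrt(-5)) (X + Y
   sqrt(-5)), so the exponent is (X^2 - 1) / 24 + 5 (Y^2 - 1) / 24. *)
have h0 : has_sum (cls 0%Z) (E 1%N * E 5%N)%C.
  apply: (has_sum_class (h := fun p : Z * Z => (3 * p.2, p.2 - p.1)%Z)
    (k := fun p : Z * Z => (p.1 / 3 - p.2, p.1 / 3)%Z) _ _ _ hK).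
  - by move=> [m n]; cbn [fst snd]; congr pair; lia.
  - residue_class.
  - move=> [m n]; rewrite /mixed_lattice; cbn [fst snd]; rewrite -!cexp_add.
    by rewrite -[RHS](cexp_period _ m); exponent.
(* This class is the image of the class k = 0 under (x, y) -> (-x, -y), that is k -> -k - 1. *)
have h2 : has_sum (cls 2%Z) (E 1%N * E 5%N)%C.
  apply: (has_sum_class (h := fun p : Z * Z => (- 3 * p.2 - 1, p.1 - p.2)%Z)
    (k := fun p : Z * Z => (p.2 - (p.1 + 1) / 3, - (p.1 + 1) / 3)%Z) _ _ _ hK).
  - by move=> [m n]; cbn [fst snd]; congr pair; lia.
  - residue_class.
  - move=> [m n]; rewrite /mixed_lattice; cbn [fst snd]; rewrite -!cexp_add.
    by rewrite -[RHS](cexp_period _ n); exponent.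
(* The class k = 1 mod 3 is the whole lattice minus the two evaluated classes. Its total d is twice
   the difference of the two sides of the claim, so it remains to show d = 0. *)
have hd := has_sum_add (has_sum_add hev hod)
  (has_sum_add (has_sum_scal (- (1))%C h0) (has_sum_scal (- (1))%C h2)).
set d := (_ + _)%C in hd.
have {}hd : has_sum (cls 1%Z) d.
  apply: has_sum_ext hd => p; rewrite /cls -Z.negb_even.
  have : (p.1 mod 3 = 0 \/ p.1 mod 3 = 1 \/ p.1 mod 3 = 2)%Z by lia.
  move: (mixed_lattice s p) => x.
  by case: (Z.even p.2) => -[->|[->|->]] /=; ring.
pose sg (p : Z * Z) := (p.1, 2 * (p.1 / 3) + 1 - p.2)%Z.
have sgK : cancel sg sg by move=> [m n]; rewrite /sg; cbn [fst snd]; congr pair; lia.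
(* The reflection v -> 2u + 1 - v preserves the exponent on the class k = 3u + 1
   and reverses the sign, so that this class sums to zero. *)
have hneg : has_sum (cls 1%Z) (- (1) * d)%C.
  have := has_sum_scal (- (1))%C (has_sum_bij sgK sgK hd).
  apply: has_sum_ext => -[m n]; rewrite /cls /sg; cbn [fst snd].
  case: ifP => [/Z.eqb_eq h|_]; last by ring.
  have [u hu] : exists u, m = (3 * u + 1)%Z by exists (m / 3)%Z; lia.
  rewrite (_ : m / 3 = u)%Z; last by lia.
  rewrite -cexp_PI /mixed_lattice; cbn [fst snd]; rewrite -cexp_add hu.
  by rewrite -[LHS](cexp_period _ (n - u - 1)); exponent.
have d0 : d = RtoC 0.
  have e := has_sum_unique hd hneg.
  have -> : d = ((d - (- (1) * d)) / 2)%C by field.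
  by rewrite -e; field.
move: d0; rewrite /d => d0.
have -> : (psi 2%N * phi 5%N - cexp s * psi 10%N * phi 1%N =
  (2 * psi 2%N * phi 5%N + - (2 * cexp s * psi 10%N * phi 1%N) +
  (- (1) * (E 1%N * E 5%N) + - (1) * (E 1%N * E 5%N))) / 2 + E 1%N * E 5%N)%C by field.
by rewrite d0; field.
Qed.

(** * The modular equations *)

(** A fixed logarithm of q, through which all fractional powers are taken without choosing a
    branch. *)
Definition qlog (tau : C) : C := (RtoC (2 * PI) * (Ci * tau))%C.

Lemma Re_qlog (tau : C) : 0 < Im tau -> Re (qlog tau) < 0.
Proof.
by move=> h; rewrite /qlog /Re /Im /= in h *; have := PI_RGT_0; nra.
Qed.

Lemma qlog_cscale (r : R) (tau : C) : qlog (cscale r tau) = (r * qlog tau)%C.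
Proof. by rewrite /qlog /cscale; ring. Qed.

Lemma Im_cscale (r : R) (tau : C) : 0 < r -> 0 < Im tau -> 0 < Im (cscale r tau).
Proof. by move=> r0 h; rewrite /cscale /Im /= in h *; nra. Qed.

Lemma qpowE (r : R) (tau : C) : qpow r tau = cexp (r * qlog tau)%C.
Proof. by rewrite /qpow /qlog; congr cexp; rewrite !RtoC_mult; ring. Qed.

(** * Euler quotients for [g] and [U] *)

Lemma qpoch_lim (a m : nat) (tau l : C) :
  Ccv (cprod (fun k => 1 - cexp (qlog tau) ^ (a + m * k))%C) l ->
  qpoch a m tau = l.
Proof.
move=> h; apply: infprod_unique; apply: Ccv_ext h => n.
by apply: eq_cprod => k; rewrite qpowE cexp_nat.
Qed.

Lemma qpoch_euler (tau : C) : 0 < Im tau -> qpoch 1 1 tau = euler (cexp (qlog tau)).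
Proof.
move=> h; apply: qpoch_lim.
apply: Ccv_ext (euler_cv (Cmod_cexp_lt1 (Re_qlog h))) => n.
by apply: eq_cprod => k; rewrite mul1n.
Qed.

Lemma eta_cscale (tau : C) (k : nat) (r : R) : 0 < Im tau -> r = INR k.+1 ->
  Defs.eta (cscale r tau) =
  (cexp (/ 24 * qlog tau) ^ k.+1 * euler (cexp (qlog tau) ^ k.+1))%C.
Proof.
move=> h hr; have r0 : 0 < r by rewrite hr S_INR; have := pos_INR k; lra.
rewrite /Defs.eta qpowE (qpoch_euler (Im_cscale r0 h)) qlog_cscale (cexp_IZR_nat _ hr).
congr Cmult; rewrite -cexp_nat -hr RtoC_div; last by lra.
by congr cexp; field.
Qed.

(** The powers of q^(1/24) cancel: 2 * 2 + 4 * 5 = 4 * 1 + 2 * 10. *)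
Lemma g_euler (tau : C) : 0 < Im tau ->
  let E k := euler (cexp (qlog tau) ^ k)%C in
  g tau = (E 2%N ^ 2 * E 5%N ^ 4 / (E 1%N ^ 4 * E 10%N ^ 2))%C.
Proof.
move=> h E.
have E0 k : E k.+1 <> 0%C.
  by apply: euler_neq0; apply: Cmod_Cpow_lt1; apply: Cmod_cexp_lt1; apply: Re_qlog.
have e1 : Defs.eta tau = (cexp (/ 24 * qlog tau) * E 1%N)%C.
  have <- : cscale 1 tau = tau by rewrite /cscale; ring.
  by rewrite (@eta_cscale _ 0) // Cpow_1_r /cscale Cmult_1_l.
have e2 := @eta_cscale tau 1 2 h ltac:(rewrite /=; lra).
have e5 := @eta_cscale tau 4 5 h ltac:(rewrite /=; lra).
have e10 := @eta_cscale tau 9 10 h ltac:(rewrite /=; lra).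
rewrite /g e1 e2 e5 e10.
rewrite -!/(E _); have c0 := @cexp_neq0 (/ 24 * qlog tau)%C.
by field; split; [exact: E0 | split; [exact: E0 | exact: c0]].
Qed.

Lemma qpoch_cv (a : nat) (tau : C) : 0 < Im tau ->
  Ccv (cprod (fun k => 1 - cexp (qlog tau) ^ (a + 10 * k))%C) (qpoch a 10 tau).
Proof.
move=> h; set q := cexp _.
have q1 : Cmod q < 1 by apply: Cmod_cexp_lt1; apply: Re_qlog.
have [l hl] := cprod_pow_cv (- q ^ a)%C (Cmod_Cpow_lt1 9 q1).
have {}hl : Ccv (cprod (fun k => 1 - q ^ (a + 10 * k))%C) l.
  apply: Ccv_ext hl => n; apply: eq_cprod => k.
  by rewrite -Cpow_mult_r (Cpow_add_r _ a) multE; ring.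
by rewrite (qpoch_lim hl).
Qed.

(** U involves every residue mod 10 except 0 and 5. Sorting the factors of E_5, E_2 and E_1 by
    residue expresses the even and the odd block through Euler products; squaring removes the
    remaining q^(1/2). *)
Lemma U_euler (tau : C) : 0 < Im tau ->
  let E k := euler (cexp (qlog tau) ^ k)%C in
  (U tau ^ 2 = cexp (qlog tau) * E 1%N ^ 2 * E 10%N ^ 4 / (E 2%N ^ 4 * E 5%N ^ 2))%C.
Proof.
move=> h; have cvL a := qpoch_cv a h; move: cvL; set q := cexp _ => cvL E.
have q1 : Cmod q < 1 by apply: Cmod_cexp_lt1; apply: Re_qlog.
have E0 k : E k.+1 <> 0%C by apply: euler_neq0; apply: Cmod_Cpow_lt1.
have cvE k : Ccv (qfac (q ^ k.+1)) (E k.+1) by apply: euler_cv; apply: Cmod_Cpow_lt1.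
pose L a := qpoch a 10 tau.
have mulcv m : forall j, exists n0, forall n, (n0 <= n)%N -> (j <= m.+1 * n)%N.
  by move=> j; exists j => n; nia.
have r10 : (L 5%N * E 10%N = E 5%N)%C.
  apply: (Ccv_unique _ (Ccv_subseq (mulcv 1%N) (cvE 4%N))).
  apply: Ccv_ext (Ccv_mult (cvL 5%N) (cvE 9%N)) => n; elim: n => [|n IH].
    by rewrite /qfac /=; ring.
  rewrite (_ : 2 * n.+1 = (2 * n).+2)%N; last by lia.
  rewrite cprodS !qfacS -IH -!Cpow_mult_r.
  rewrite (_ : (10 * n.+1)%coq_nat = (5 * (2 * n).+2)%coq_nat); last by lia.
  rewrite (_ : (5 + 10 * n)%N = (5 * (2 * n).+1)%coq_nat); last by lia.
  by ring.
have reven : (L 2%N * L 4%N * L 6%N * L 8%N * E 10%N = E 2%N)%C.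
  apply: (Ccv_unique _ (Ccv_subseq (mulcv 4%N) (cvE 1%N))).
  apply: Ccv_ext (Ccv_mult (Ccv_mult (Ccv_mult (Ccv_mult (cvL 2%N) (cvL 4%N))
    (cvL 6%N)) (cvL 8%N)) (cvE 9%N)) => n; elim: n => [|n IH].
    by rewrite /qfac /=; ring.
  rewrite (_ : 5 * n.+1 = (5 * n).+4.+1)%N; last by lia.
  rewrite !cprodS !qfacS -IH -!Cpow_mult_r.
  rewrite (_ : (10 * n.+1)%coq_nat = (2 * (5 * n).+4.+1)%coq_nat); last by lia.
  rewrite (_ : (2 + 10 * n)%N = (2 * (5 * n).+1)%coq_nat); last by lia.
  rewrite (_ : (4 + 10 * n)%N = (2 * (5 * n).+2)%coq_nat); last by lia.
  rewrite (_ : (6 + 10 * n)%N = (2 * (5 * n).+3)%coq_nat); last by lia.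
  rewrite (_ : (8 + 10 * n)%N = (2 * (5 * n).+4)%coq_nat); last by lia.
  by ring.
have rall : (L 1%N * L 3%N * L 7%N * L 9%N * L 5%N * E 2%N = E 1%N)%C.
  apply: (Ccv_unique _ (Ccv_subseq (mulcv 9%N) (cvE 0%N))).
  apply: Ccv_ext (Ccv_mult (Ccv_mult (Ccv_mult (Ccv_mult (Ccv_mult (cvL 1%N) (cvL 3%N))
    (cvL 7%N)) (cvL 9%N)) (cvL 5%N)) (Ccv_subseq (mulcv 4%N) (cvE 1%N))) => n.
  elim: n => [|n IH]; first by rewrite /qfac /=; ring.
  rewrite (_ : 5 * n.+1 = (5 * n).+4.+1)%N; last by lia.
  rewrite (_ : 10 * n.+1 = (10 * n).+4.+4.+2)%N; last by lia.
  rewrite !cprodS !qfacS -IH -!Cpow_mult_r.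
  rewrite (_ : (2 * (5 * n).+1)%coq_nat = (10 * n).+2); last by lia.
  rewrite (_ : (2 * (5 * n).+2)%coq_nat = (10 * n).+4); last by lia.
  rewrite (_ : (2 * (5 * n).+3)%coq_nat = (10 * n).+4.+2); last by lia.
  rewrite (_ : (2 * (5 * n).+4)%coq_nat = (10 * n).+4.+4); last by lia.
  rewrite (_ : (2 * (5 * n).+4.+1)%coq_nat = (10 * n).+4.+4.+2); last by lia.
  rewrite !PeanoNat.Nat.mul_1_l ?(add1n, addSn, add0n).
  by ring.
(* Each residue product is nonzero because it divides a nonvanishing Euler product. *)
have L0 (a b : C) : (a * b)%C <> 0%C -> a <> 0%C /\ b <> 0%C.
  by move=> ab; split=> e; apply: ab; rewrite e; ring.
have := E0 0%N; rewrite -rall.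
move=> /L0[/L0[/L0[/L0[/L0[n1 n3] n7] n9] n5] _].
have := E0 1%N; rewrite -reven.
move=> /L0[/L0[/L0[/L0[n2 n4] n6] n8] n10].
rewrite -r10 /U /Ifun /Jfun -!/(L _) !qpowE.
pose a := cexp (/ 4 * qlog tau)%C.
have a0 : a <> 0%C by apply: cexp_neq0.
have -> : q = (a ^ 4)%C by rewrite /a -(@cexp_IZR_nat 4 4); [congr cexp; field | rewrite /=; lra].
have -> : cexp (RtoC (3 / 4) * qlog tau)%C = (a ^ 3)%C.
  rewrite /a -(@cexp_IZR_nat 3 3); last by rewrite /=; lra.
  by rewrite RtoC_div; [congr cexp; field | lra].
have -> : cexp (RtoC (1 / 4) * qlog tau)%C = a.
  by rewrite /a RtoC_div; [congr cexp; field | lra].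
by field; repeat split.
Qed.

Theorem theorem4p5 : forall tau : C, 0 < Im tau ->
  (let x := g tau in let y := g (cscale 2 tau) in
   (x - x ^ 2 - 4 * x * y - y ^ 2 + 5 * x * y ^ 2 = 0)%C) /\
  (let u := U tau in let v := U (cscale 2 tau) in
   (u ^ 4 + 4 * u ^ 2 * v ^ 2 + v ^ 4 = v ^ 2 * (1 + 5 * u ^ 4))%C).
Proof.
move=> tau h.
have h2 : 0 < Im (cscale 2 tau) by apply: Im_cscale => //; lra.
have gE := g_euler h; have gE2 := g_euler h2.
have UE := U_euler h; have UE2 := U_euler h2.
have A1 := psi_quintic (Re_qlog h); have A2 := psi_quintic (Re_qlog h2).
have B1 := psi_quintic_conjugate (Re_qlog h).
have B2 := psi_quintic_conjugate (Re_qlog h2).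
have mixed := psi_phi_quintic (Re_qlog h).
have eq2 : cexp (qlog (cscale 2 tau)) = (cexp (qlog tau) ^ 2)%C.
  by rewrite qlog_cscale; apply: cexp_IZR_nat => /=; lra.
rewrite !eq2 in gE2 UE2 A2 B2.
have q1 := Cmod_cexp_lt1 (Re_qlog h).
have q0 := @cexp_neq0 (qlog tau).
move: gE gE2 UE UE2 A1 A2 B1 B2 mixed q1 q0.
set q := cexp (qlog tau) => gE gE2 UE UE2 A1 A2 B1 B2 mixed q1 q0.
pose E k := euler (q ^ k)%C.
have E0 k : E k.+1 <> 0%C by apply: euler_neq0; apply: Cmod_Cpow_lt1.
cbv beta zeta in gE, gE2, UE, UE2, A1, A2, B1, B2, mixed.
rewrite -!Cpow_mult_r in gE2 UE2 A2 B2.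
rewrite -!/(E _) in gE gE2 UE UE2 A1 A2 B1 B2 mixed.
change (2 * 2)%coq_nat with 4%N in gE2, UE2, A2, B2, mixed.
change (2 * 10)%coq_nat with 20%N in gE2, UE2, A2, B2, mixed.
have n1 := E0 0%N; have n2 := E0 1%N; have n4 := E0 3%N; have n5 := E0 4%N.
have n10 := E0 9%N; have n20 := E0 19%N.
set A := (U tau ^ 2)%C in UE; set B := (U (cscale 2 tau) ^ 2)%C in UE2.
(* The identities for psi(q)^2 are divided by psi(q)^2 = E_2^4 / E_1^2, here and for 1 - 5 A, and
   likewise at 2 tau. *)
have hA : (1 - A = E 5%N ^ 3 * E 1%N / (E 10%N * E 2%N ^ 3))%C.
  have -> : (1 - A = E 1%N ^ 2 / E 2%N ^ 4 *
      (E 2%N ^ 4 / E 1%N ^ 2 - q * E 10%N ^ 4 / E 5%N ^ 2))%C.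
    by rewrite UE; field.
  by rewrite A1; field.
have hA5 : (1 - 5 * A = E 1%N ^ 5 * E 10%N / (E 2%N ^ 5 * E 5%N))%C.
  have -> : (1 - 5 * A = E 1%N ^ 2 / E 2%N ^ 4 *
      (E 2%N ^ 4 / E 1%N ^ 2 - 5 * q * E 10%N ^ 4 / E 5%N ^ 2))%C.
    by rewrite UE; field.
  by rewrite B1; field.
have hB : (1 - B = E 10%N ^ 3 * E 2%N / (E 20%N * E 4%N ^ 3))%C.
  have -> : (1 - B = E 2%N ^ 2 / E 4%N ^ 4 *
      (E 4%N ^ 4 / E 2%N ^ 2 - q ^ 2 * E 20%N ^ 4 / E 10%N ^ 2))%C.
    by rewrite UE2; field.
  by rewrite A2; field.
have hB5 : (1 - 5 * B = E 2%N ^ 5 * E 20%N / (E 4%N ^ 5 * E 10%N))%C.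
  have -> : (1 - 5 * B = E 2%N ^ 2 / E 4%N ^ 4 *
      (E 4%N ^ 4 / E 2%N ^ 2 - 5 * q ^ 2 * E 20%N ^ 4 / E 10%N ^ 2))%C.
    by rewrite UE2; field.
  by rewrite B2; field.
have hAB : (A - B = q * E 20%N ^ 2 * E 1%N ^ 3 * E 5%N /
    (E 10%N * E 2%N ^ 3 * E 4%N ^ 2))%C.
  have -> : (A - B = q * E 20%N ^ 2 * E 1%N ^ 2 / (E 10%N * E 2%N ^ 3 * E 4%N ^ 2) *
      (E 4%N ^ 2 / E 2%N * (E 10%N ^ 5 / (E 5%N ^ 2 * E 20%N ^ 2)) -
       q * (E 20%N ^ 2 / E 10%N) * (E 2%N ^ 5 / (E 1%N ^ 2 * E 4%N ^ 2))))%C.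
    by rewrite UE UE2; field; repeat split.
  by rewrite mixed; field.
have core : ((A - B) ^ 2 = B * (1 - A) * (1 - 5 * A))%C.
  by rewrite hAB hA hA5 UE2; field.
(* The product form shows that the denominators of g do not vanish. *)
have nA : (1 - 5 * A)%C <> 0%C.
  move=> e; apply: (Cmult_neq_0 _ _ (Cpow_nz _ 5 n1) n10).
  have -> : (E 1%N ^ 5 * E 10%N = (1 - 5 * A) * (E 2%N ^ 5 * E 5%N))%C.
    by rewrite hA5; field.
  by rewrite e; ring.
have nB : (1 - 5 * B)%C <> 0%C.
  move=> e; apply: (Cmult_neq_0 _ _ (Cpow_nz _ 5 n2) n20).
  have -> : (E 2%N ^ 5 * E 20%N = (1 - 5 * B) * (E 4%N ^ 5 * E 10%N))%C.
    by rewrite hB5; field.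
  by rewrite e; ring.
have gA : g tau = ((1 - A) / (1 - 5 * A))%C.
  by rewrite gE hA hA5; field; repeat split.
have gB : g (cscale 2 tau) = ((1 - B) / (1 - 5 * B))%C.
  by rewrite gE2 hB hB5; field; repeat split.
split; cbv zeta.
  rewrite gA gB.
  set x := (_ / (1 - 5 * A))%C; set y := (_ / (1 - 5 * B))%C.
  (* Clearing denominators in the Möbius substitution leaves the defect of [core] times the constant
     -16. *)
  have -> : (x - x ^ 2 - 4 * x * y - y ^ 2 + 5 * x * y ^ 2 =
    - (16) * ((A - B) ^ 2 - B * (1 - A) * (1 - 5 * A)) /
    ((1 - 5 * A) ^ 2 * (1 - 5 * B) ^ 2))%C.
    by rewrite /x /y; field.
  by rewrite core; field.
have -> : (U tau ^ 4 = A ^ 2)%C by rewrite /A; ring.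
have -> : (U (cscale 2 tau) ^ 4 = B ^ 2)%C by rewrite /B; ring.
rewrite -/A -/B.
have -> : (A ^ 2 + 4 * A * B + B ^ 2 =
  ((A - B) ^ 2 - B * (1 - A) * (1 - 5 * A)) + B * (1 + 5 * A ^ 2))%C by ring.
by rewrite core; ring.
Qed.
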